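(* Let $G=\operatorname{PGL}_2(\mathbb{R})$, $\Gamma=\operatorname{PGL}_2(\mathbb{Z})$, $X=\Gamma\backslash G$ and $H=\{\operatorname{diag}(e^{t/2},e^{-t/2}):t\in\mathbb{R}\}$ (so the $H$-action is the geodesic flow on the unit tangent bundle of the modular surface). For every $\varepsilon>0$ there exists $\delta>0$ such that $$\sum_{\Gamma gH \text{ periodic},\ \operatorname{disc}(\Gamma gH)\le \Delta,\ \Gamma gH\subset \Omega'_\delta}\mathrm{vol}(\Gamma gH)\gg_\varepsilon \Delta^{1-\varepsilon}.$$
   Context: A periodic $H$-orbit is a compact $H$-orbit; its volume is the covolume of $g^{-1}\Gamma g\cap H$ in $H$, measured with the parameter $t$ (i.e. the length of the closed geodesic). Its discriminant is defined as follows: with $\mathfrak g=M_2(\mathbb{Q})/\mathbb{Q} I$, $\mathfrak g_{\mathbb Z}$ the image of $M_2(\mathbb Z)$, and $B(X,Y)=\operatorname{tr}(1)\operatorname{tr}(XY)-\operatorname{tr}(X)\operatorname{tr}(Y)$ (tr = trace of left multiplication on $M_2(\mathbb{Q})$), $\operatorname{disc}(\Gamma gH)=B(e,e)$ where $e$ generates the rank one lattice $\operatorname{Ad}(g)\mathfrak h\cap\mathfrak g_{\mathbb Z}$; it is a fixed constant multiple of the discriminant of the associated real quadratic order. For $\delta>0$, identifying $\Gamma g$ with the homothety class of the lattice $\mathbb{Z}^2 g\subset\mathbb{R}^2$, $\Omega'_\delta=\{\Gamma g\in X: \|mg\|_\infty^2\ge \delta|\det g| \text{ for all nonzero } m\in\mathbb{Z}^2\}$,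 a compact set. *)

(* Defs.v *)
From HB Require Import structures.
From mathcomp Require Import all_boot all_order all_algebra.
From mathcomp Require Import all_classical all_reals all_analysis.
From mathcomp Require Import Rstruct Rstruct_topology.
Set Implicit Arguments. Unset Strict Implicit. Unset Printing Implicit Defensive.
Import Order.TTheory GRing.Theory Num.Theory.
Import numFieldNormedType.Exports.
Local Open Scope classical_set_scope.
Local Open Scope ring_scope.

Notation RR := Rdefinitions.R.

(* Elements of G = PGL_2(R) are represented by invertible real 2x2 matrices
   (modulo nonzero scalars, see gamma_equiv).  A point Gamma g of
   X = PGL_2(Z)\PGL_2(R) is represented by any g with g \in unitmx. *)

Definition intmx (M : 'M[int]_2) : 'M[RR]_2 := map_mx (fun z : int => z%:~R) M.

(* Gamma g = Gamma g' in X : g' = lambda * gamma * g with gamma in GL_2(Z),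
   lambda a nonzero real scalar (so gamma ranges over PGL_2(Z) inside PGL_2(R)). *)
Definition gamma_equiv (g g' : 'M[RR]_2) : Prop :=
  exists (M : 'M[int]_2) (lam : RR),
    (\det M = 1 \/ \det M = -1) /\ lam != 0 /\ g' = lam *: (intmx M *m g).

Definition a_t (t : RR) : 'M[RR]_2 :=
  \matrix_(i < 2, j < 2)
    (if i == j then (if (i : nat) == 0%N then expR (t / 2) else expR (- (t / 2))) else 0).

(* The H-orbit Gamma g H, as the (Gamma x scalars)-saturated set of matrices
   representing its points. *)
Definition orbitset (g : 'M[RR]_2) : set 'M[RR]_2 :=
  [set x | exists t : RR, gamma_equiv (g *m a_t t) x].

(* Open sets of X = quotient topology: open subsets of GL_2(R) (GL_2(R) is open in
   M_2(R)) that are saturated for gamma_equiv. *)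
Definition X_open (U : set 'M[RR]_2) : Prop :=
  open U /\ (forall x, U x -> x \in unitmx) /\
  (forall x y, U x -> gamma_equiv x y -> U y).

Definition X_compact (S : set 'M[RR]_2) : Prop :=
  forall (I : Type) (U : I -> set 'M[RR]_2),
    (forall i, X_open (U i)) ->
    (forall x, S x -> exists i, U i x) ->
    exists J : seq I, forall x, S x -> exists i, List.In i J /\ U i x.

Definition periodic_orbit (g : 'M[RR]_2) : Prop := X_compact (orbitset g).

(* vol(Gamma g H) = v : the covolume in H (parameter t) of the stabiliser
   g^{-1} Gamma g \cap H, i.e. the least t > 0 with Gamma g a_t = Gamma g. *)
Definition is_vol (g : 'M[RR]_2) (v : RR) : Prop :=
  0 < v /\ gamma_equiv g (g *m a_t v) /\
  (forall t, 0 < t -> t < v -> ~ gamma_equiv g (g *m a_t t)).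

Definition trL (A : 'M[RR]_2) : RR := \tr (lin_mx (@mulmx RR 2 2 2 A)).
Definition Bform (A B : 'M[RR]_2) : RR :=
  trL 1%:M * trL (A *m B) - trL A * trL B.

(* D = diag(1,-1) spans the Lie algebra h of H; Ad(g) h is spanned by g D g^{-1}
   (modulo scalars, since g = M_2/scalars). *)
Definition Dh : 'M[RR]_2 :=
  \matrix_(i < 2, j < 2) (if i == j then (if (i : nat) == 0%N then 1 else -1) else 0).
Definition in_Adh (g A : 'M[RR]_2) : Prop :=
  exists s c : RR, A = s *: (g *m Dh *m invmx g) + c%:M.

(* disc(Gamma g H) = d : d = B(e,e) where (the class of) e generates the rank one
   lattice Ad(g) h \cap g_Z inside M_2(Q)/Q I. *)
Definition is_disc (g : 'M[RR]_2) (d : RR) : Prop :=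
  exists e : 'M[int]_2,
    in_Adh g (intmx e) /\
    ~ (exists c : RR, intmx e = c%:M) /\
    (forall f : 'M[int]_2, in_Adh g (intmx f) ->
       exists (k : int) (c : RR), intmx f = k%:~R *: intmx e + c%:M) /\
    d = Bform (intmx e) (intmx e).

Definition normInf (v : 'rV[RR]_2) : RR := Num.max `|v 0 0| `|v 0 1|.

Definition in_Omega' (delta : RR) (x : 'M[RR]_2) : Prop :=
  forall m : 'rV[int]_2, m != 0 ->
    delta * `|\det x| <= normInf (map_mx (fun z : int => z%:~R) m *m x) ^+ 2.

(* Main.v *)
(* A product [A] of positive matrices of SL_2(Z) determines the periodic orbit through the
   matrix whose columns are the expanding and contracting eigenvectors of [A]; its
   discriminant is at most [4 (tr A)^2], hence at most [16 (2r)^(2k)] for a product of [k]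
   matrices with entries at most [r].  If the factors come from a fixed finite set, the orbits
   stay in one compact set.  Consider the matrices with first column [(a, c)], where
   [a < c <= K] are coprime, and [K < d <= 2K]: they map the positive quadrant into disjoint
   cones, so they freely generate a semigroup, and there are at least [(K/4)^2] of
   them while [r = 2K].  So there are at least [(K/4)^(2k)] words of length [k] for a discriminant
   bound [16 (4K)^(2k)], which gives the exponent [1 - eps] once [K] is large.  Distinct
   words of equal length have distinct axes, because hyperbolic matrices with the
   same axis commute; and an orbit of volume [v] carries [O(v)] of these axes, because two
   of them at time distance at most 1 differ by an element of a fixed finite subset of
   GL_2(Z). *)
Require Import Defs.
From HB Require Import structures.
From mathcomp Require Import all_boot all_order all_algebra.
From mathcomp Require Import all_classical all_reals all_analysis.
From mathcomp Require Import Rstruct Rstruct_topology.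
From mathcomp Require Import ring lra zify.
From mathcomp Require cyclic.
Import Order.TTheory GRing.Theory Num.Theory.
Import numFieldNormedType.Exports.
Local Open Scope classical_set_scope.
Local Open Scope ring_scope.
Set Implicit Arguments.
Unset Strict Implicit.
Unset Printing Implicit Defensive.

(** * Two by two matrices and orbits *)

Definition mx2 {T : Type} (a b c d : T) : 'M[T]_2 :=
  \matrix_(i < 2, j < 2)
    (if (i : nat) == 0%N then (if (j : nat) == 0%N then a else b)
     else (if (j : nat) == 0%N then c else d)).

Lemma mx2E00 (T : Type) (a b c d : T) : mx2 a b c d 0 0 = a.
Proof. by rewrite mxE. Qed.
Lemma mx2E01 (T : Type) (a b c d : T) : mx2 a b c d 0 1 = b.
Proof. by rewrite mxE. Qed.
Lemma mx2E10 (T : Type) (a b c d : T) : mx2 a b c d 1 0 = c.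
Proof. by rewrite mxE. Qed.
Lemma mx2E11 (T : Type) (a b c d : T) : mx2 a b c d 1 1 = d.
Proof. by rewrite mxE. Qed.
Definition mx2E := (mx2E00, mx2E01, mx2E10, mx2E11).

Lemma ord2P (P : 'I_2 -> Prop) : P 0 -> P 1 -> forall i, P i.
Proof.
move=> P0 P1 [[|[|//]] i2].
  by have -> : Ordinal i2 = 0 by apply: val_inj.
by have -> : Ordinal i2 = 1 by apply: val_inj.
Qed.

Lemma mx2P (T : Type) (A B : 'M[T]_2) :
  A 0 0 = B 0 0 -> A 0 1 = B 0 1 -> A 1 0 = B 1 0 -> A 1 1 = B 1 1 -> A = B.
Proof. by move=> *; apply/matrixP; do 2!apply: ord2P => //. Qed.

Lemma mx2_eta (T : Type) (A : 'M[T]_2) : A = mx2 (A 0 0) (A 0 1) (A 1 0) (A 1 1).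
Proof. by apply: mx2P; rewrite !mx2E. Qed.

Lemma sum_ord2 (V : nmodType) (F : 'I_2 -> V) : \sum_(i < 2) F i = F 0 + F 1.
Proof.
rewrite big_ord_recl big_ord1; congr (_ + F _); exact: val_inj.
Qed.

Lemma mulmx22E (T : pzSemiRingType) m n (A : 'M[T]_(m, 2)) (B : 'M[T]_(2, n)) i j :
  (A *m B) i j = A i 0 * B 0 j + A i 1 * B 1 j.
Proof. by rewrite mxE sum_ord2. Qed.

Lemma mul_mx2 (T : pzSemiRingType) (a b c d a' b' c' d' : T) :
  mx2 a b c d *m mx2 a' b' c' d' =
  mx2 (a * a' + b * c') (a * b' + b * d') (c * a' + d * c') (c * b' + d * d').
Proof. by apply: mx2P; rewrite mulmx22E !mx2E. Qed.

Lemma scale_mx2 (T : pzSemiRingType) (k a b c d : T) :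
  k *: mx2 a b c d = mx2 (k * a) (k * b) (k * c) (k * d).
Proof. by apply: mx2P; rewrite !mxE. Qed.

Lemma add_mx2 (T : nmodType) (a b c d a' b' c' d' : T) :
  mx2 a b c d + mx2 a' b' c' d' = mx2 (a + a') (b + b') (c + c') (d + d').
Proof. by apply: mx2P; rewrite !mxE. Qed.

Lemma scalar_mx2 (T : pzSemiRingType) (a : T) : a%:M = mx2 a 0 0 a.
Proof. by apply: mx2P; rewrite !mxE. Qed.

Lemma det_mx2 (T : comPzRingType) (A : 'M[T]_2) :
  \det A = A 0 0 * A 1 1 - A 0 1 * A 1 0.
Proof.
rewrite (expand_det_row A 0) sum_ord2 /cofactor !det_mx11 !mxE /=.
rewrite expr0 expr1 mul1r mulN1r mulrN.
congr (A _ _ * A _ _ - A _ _ * A _ _); exact: val_inj.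
Qed.

Lemma trace_mx2 (T : pzSemiRingType) (A : 'M[T]_2) : \tr A = A 0 0 + A 1 1.
Proof. by rewrite /mxtrace sum_ord2. Qed.

Lemma mx2_inj (T : Type) (a b c d a' b' c' d' : T) :
  mx2 a b c d = mx2 a' b' c' d' -> [/\ a = a', b = b', c = c' & d = d'].
Proof.
move=> e; split.
- by rewrite -(mx2E00 a b c d) e mx2E.
- by rewrite -(mx2E01 a b c d) e mx2E.
- by rewrite -(mx2E10 a b c d) e mx2E.
- by rewrite -(mx2E11 a b c d) e mx2E.
Qed.

Lemma intmx_mx2 (a b c d : int) :
  intmx (mx2 a b c d) = mx2 (a%:~R : RR) b%:~R c%:~R d%:~R.
Proof. by apply: mx2P; rewrite !mxE. Qed.

Lemma intmxE (M : 'M[int]_2) i j : intmx M i j = (M i j)%:~R.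
Proof. by rewrite mxE. Qed.

Lemma intmxM (A B : 'M[int]_2) : intmx (A *m B) = intmx A *m intmx B.
Proof. exact: map_mxM. Qed.

Lemma intmx1 : intmx 1%:M = 1%:M.
Proof. exact: map_mx1. Qed.

Lemma det_intmx (A : 'M[int]_2) : \det (intmx A) = (\det A)%:~R.
Proof. exact: det_map_mx. Qed.

Lemma intmx_inj (A B : 'M[int]_2) : intmx A = intmx B -> A = B.
Proof.
move=> /matrixP e; apply/matrixP => i j.
by have := e i j; rewrite !mxE => /intr_inj.
Qed.

Lemma a_tE (t : RR) : a_t t = mx2 (expR (t / 2)) 0 0 (expR (- (t / 2))).
Proof. by apply: mx2P; rewrite !mxE. Qed.

Lemma a_t0 : a_t 0 = 1%:M.
Proof. by rewrite a_tE mul0r oppr0 exp.expR0 scalar_mx2. Qed.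

Lemma a_tD (s t : RR) : a_t (s + t) = a_t s *m a_t t.
Proof.
rewrite !a_tE mul_mx2 !(mulr0, mul0r, add0r, addr0) -!exp.expRD.
by congr mx2; congr expR; rewrite !mulrDl ?opprD.
Qed.

Lemma det_a_t (t : RR) : \det (a_t t) = 1.
Proof. by rewrite a_tE det_mx2 !mx2E mul0r subr0 -exp.expRD subrr exp.expR0. Qed.

Lemma gamma_equiv_refl (g : 'M[RR]_2) : gamma_equiv g g.
Proof.
exists 1%:M, 1; rewrite det1; split; [by left|split; first exact: oner_neq0].
by rewrite intmx1 mul1mx scale1r.
Qed.

Lemma gamma_equiv_trans (g h k : 'M[RR]_2) :
  gamma_equiv g h -> gamma_equiv h k -> gamma_equiv g k.
Proof.
move=> [M [l [dM [l0 ->]]]] [M' [l' [dM' [l'0 ->]]]].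
exists (M' *m M), (l' * l); split.
  rewrite det_mulmx; case: dM => ->; case: dM' => ->;
  by rewrite ?mulr1 ?mulrN ?mul1r ?mulr1 ?opprK; auto.
split; first by rewrite mulf_neq0.
by rewrite intmxM -scalemxAr scalerA mulmxA.
Qed.

Lemma gamma_equiv_sym (g h : 'M[RR]_2) : gamma_equiv g h -> gamma_equiv h g.
Proof.
move=> [M [l [dM [l0 ->]]]].
have uM : M \in unitmx by rewrite unitmxE; case: dM => ->.
exists (invmx M), l^-1; split.
  by rewrite det_inv; case: dM => ->; [left|right].
split; first by rewrite invr_eq0.
by rewrite -scalemxAr scalerA mulVf // scale1r mulmxA -intmxM mulVmx // intmx1 mul1mx.
Qed.

Lemma gamma_equivMr (g h a : 'M[RR]_2) :
  gamma_equiv g h -> gamma_equiv (g *m a) (h *m a).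
Proof.
move=> [M [l [dM [l0 ->]]]]; exists M, l; split => //; split => //.
by rewrite -scalemxAl mulmxA.
Qed.

Lemma orbitset_eqP (g h : 'M[RR]_2) :
  orbitset g = orbitset h <-> exists t, gamma_equiv (g *m a_t t) h.
Proof.
split=> [e|[t e]].
  have : orbitset h h by exists 0; rewrite a_t0 mulmx1; exact: gamma_equiv_refl.
  by rewrite -e => -[t et]; exists t.
have e' : gamma_equiv (h *m a_t (- t)) g.
  have := gamma_equivMr (a_t (- t)) (gamma_equiv_sym e).
  by rewrite -mulmxA -a_tD subrr a_t0 mulmx1.
apply/seteqP; split => x [s es].
- exists (- t + s); rewrite a_tD mulmxA.
  exact: gamma_equiv_trans (gamma_equivMr _ e') es.
- exists (t + s); rewrite a_tD mulmxA.
  exact: gamma_equiv_trans (gamma_equivMr _ e) es.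
Qed.

(** * Eigenvectors of positive matrices *)

(** Comparability within a factor [r] along rows and columns does not degrade under products of
    positive matrices, whereas the entries themselves grow. It therefore confines the eigenvectors
    of words of every length to one compact range. *)
Record balanced (r : RR) (A : 'M[RR]_2) : Prop := Balanced {
  bal_gt0 : forall i j, 0 < A i j;
  bal_det : A 0 0 * A 1 1 - A 0 1 * A 1 0 = 1;
  bal_row : forall i j j', A i j <= r * A i j';
  bal_col : forall i i' j, A i j <= r * A i' j }.

Section Eigen.
Variables (r : RR) (A : 'M[RR]_2).

(** For determinant 1, [chdisc] is the discriminant of the characteristic polynomial. The numbers
    [xi] and [- eta] are the attracting and repelling fixed points of the Möbius action, and [lam]
    and [mu] are the eigenvalues. *)
Definition chdisc : RR := (A 0 0 + A 1 1) ^+ 2 - 4.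
Definition xi : RR := (A 0 0 - A 1 1 + Num.sqrt chdisc) / (2 * A 1 0).
Definition eta : RR := (A 1 1 - A 0 0 + Num.sqrt chdisc) / (2 * A 1 0).
Definition lam : RR := (A 0 0 + A 1 1 + Num.sqrt chdisc) / 2.
Definition mu : RR := (A 0 0 + A 1 1 - Num.sqrt chdisc) / 2.

(* The columns of [eigmx] are the expanding and contracting eigenvectors of [A]. *)
Definition eigmx : 'M[RR]_2 := mx2 xi (- eta) 1 1.

Hypothesis bA : balanced r A.

Local Notation s := (Num.sqrt chdisc).

Lemma chdiscE : chdisc = (A 0 0 - A 1 1) ^+ 2 + 4 * (A 0 1 * A 1 0).
Proof.
have -> : A 0 1 * A 1 0 = A 0 0 * A 1 1 - 1 by rewrite -(bal_det bA); ring.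
by rewrite /chdisc; ring.
Qed.

Lemma chdisc_gt0 : 0 < chdisc.
Proof.
by rewrite chdiscE ltr_wpDl ?sqr_ge0 // !mulr_gt0 ?(bal_gt0 bA).
Qed.

Lemma sqrt_chdisc_gt0 : (0 : RR) < s. Proof. by rewrite sqrtr_gt0 chdisc_gt0. Qed.
Lemma sqr_sqrt_chdisc : s ^+ 2 = chdisc. Proof. by rewrite sqr_sqrtr // ltW // chdisc_gt0. Qed.

Lemma ltr_sqrt_chdisc : `|A 0 0 - A 1 1| < s.
Proof.
rewrite -ltr_sqr ?nnegrE ?normr_ge0 ?sqrtr_ge0 // sqr_sqrt_chdisc real_normK ?num_real // chdiscE.
by rewrite ltrDl !mulr_gt0 ?(bal_gt0 bA).
Qed.

Lemma xi_gt0 : 0 < xi.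
Proof.
have := ltr_sqrt_chdisc; rewrite ltr_norml => /andP[h1 h2].
by rewrite divr_gt0 ?mulr_gt0 ?(bal_gt0 bA) //; lra.
Qed.

Lemma eta_gt0 : 0 < eta.
Proof.
have := ltr_sqrt_chdisc; rewrite ltr_norml => /andP[h1 h2].
by rewrite divr_gt0 ?mulr_gt0 ?(bal_gt0 bA) //; lra.
Qed.

Lemma mul10_xi : A 1 0 * xi = (A 0 0 - A 1 1 + s) / 2.
Proof. by rewrite /xi; field; rewrite gt_eqF ?(bal_gt0 bA). Qed.
Lemma mul10_eta : A 1 0 * eta = (A 1 1 - A 0 0 + s) / 2.
Proof. by rewrite /eta; field; rewrite gt_eqF ?(bal_gt0 bA). Qed.

Lemma mul10_inj (x y : RR) : A 1 0 * x = A 1 0 * y -> x = y.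
Proof. by apply: mulfI; rewrite gt_eqF ?(bal_gt0 bA). Qed.

Lemma mul01_10 : A 0 1 * A 1 0 = (s ^+ 2 - (A 0 0 - A 1 1) ^+ 2) / 4.
Proof. by rewrite sqr_sqrt_chdisc chdiscE; field. Qed.

Lemma lamD_mu : lam + mu = A 0 0 + A 1 1.
Proof. by rewrite /lam /mu; field. Qed.

Lemma lam_mu : lam * mu = 1.
Proof.
have -> : lam * mu = ((A 0 0 + A 1 1) ^+ 2 - s ^+ 2) / 4 by rewrite /lam /mu; field.
by rewrite sqr_sqrt_chdisc /chdisc; field.
Qed.

Lemma eig_xi1 : A 1 0 * xi + A 1 1 = lam.
Proof. by rewrite mul10_xi /lam; field. Qed.

Lemma eig_xi0 : A 0 0 * xi + A 0 1 = lam * xi.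
Proof.
apply: mul10_inj; have -> : A 1 0 * (lam * xi) = lam * (A 1 0 * xi) by ring.
have -> : A 1 0 * (A 0 0 * xi + A 0 1) = A 0 0 * (A 1 0 * xi) + A 0 1 * A 1 0 by ring.
by rewrite mul01_10 mul10_xi /lam; field.
Qed.

Lemma eig_eta1 : A 1 0 * eta + A 0 0 = lam.
Proof. by rewrite mul10_eta /lam; field. Qed.

Lemma eig_eta0 : A 1 1 * eta + A 0 1 = lam * eta.
Proof.
apply: mul10_inj; have -> : A 1 0 * (lam * eta) = lam * (A 1 0 * eta) by ring.
have -> : A 1 0 * (A 1 1 * eta + A 0 1) = A 1 1 * (A 1 0 * eta) + A 0 1 * A 1 0 by ring.
by rewrite mul01_10 mul10_eta /lam; field.
Qed.

Lemma lam_gt1 : 1 < lam.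
Proof.
have D0 := chdisc_gt0; rewrite /chdisc in D0.
have t2 : 2 < A 0 0 + A 1 1.
  rewrite -ltr_sqr ?nnegrE.
  - rewrite -subr_gt0; apply: lt_le_trans D0 _; rewrite lerB // expr2; lra.
  - by [].
  - by rewrite addr_ge0 // ltW // (bal_gt0 bA).
by have := sqrt_chdisc_gt0; rewrite /lam; lra.
Qed.

Lemma lam_gt0 : 0 < lam. Proof. exact: lt_trans lam_gt1. Qed.

Lemma muE : mu = lam^-1.
Proof. by apply: (mulfI (lt0r_neq0 lam_gt0)); rewrite lam_mu divff // gt_eqF ?lam_gt0. Qed.

(** By comparability of columns, the Möbius map of [A] sends every positive number into the interval
    from [1/r] to [r], and [xi] is a positive fixed point. For [eta] the same argument uses the
    rows. *)
Lemma xi_ler : xi <= r.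
Proof.
have h x y p q : x <= r * p -> y <= r * q -> x * xi + y <= r * (p * xi + q).
  by move=> hx hy; rewrite mulrDr mulrA lerD // ler_pM2r ?xi_gt0.
rewrite -(ler_pM2l lam_gt0) -eig_xi0 -eig_xi1 [leRHS]mulrC.
apply: h; apply: (bal_col bA).
Qed.

Lemma xi_geVr : 1 <= r * xi.
Proof.
have h x y p q : x <= r * p -> y <= r * q -> x * xi + y <= r * (p * xi + q).
  by move=> hx hy; rewrite mulrDr mulrA lerD // ler_pM2r ?xi_gt0.
rewrite -(ler_pM2l lam_gt0) mulr1 mulrCA -eig_xi0 -{1}eig_xi1.
by apply: h; apply: (bal_col bA).
Qed.

Lemma eta_ler : eta <= r.
Proof.
have h x y p q : x <= r * p -> y <= r * q -> x * eta + y <= r * (p * eta + q).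
  by move=> hx hy; rewrite mulrDr mulrA lerD // ler_pM2r ?eta_gt0.
rewrite -(ler_pM2l lam_gt0) -eig_eta0 -eig_eta1 [leRHS]mulrC.
by apply: h; apply: (bal_row bA).
Qed.

Lemma eta_geVr : 1 <= r * eta.
Proof.
have h x y p q : x <= r * p -> y <= r * q -> x * eta + y <= r * (p * eta + q).
  by move=> hx hy; rewrite mulrDr mulrA lerD // ler_pM2r ?eta_gt0.
rewrite -(ler_pM2l lam_gt0) mulr1 mulrCA -eig_eta0 -{1}eig_eta1.
by apply: h; apply: (bal_row bA).
Qed.

Lemma eig_xi_unique p q : A 1 0 * p + A 1 1 * q = lam * q -> p = q * xi.
Proof.
move=> e; apply: mul10_inj; rewrite mulrCA.
have -> : A 1 0 * xi = lam - A 1 1 by rewrite -eig_xi1; ring.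
by rewrite mulrBr [q * lam]mulrC -e; ring.
Qed.

Lemma eig_eta_unique p q : A 1 0 * p + A 1 1 * q = mu * q -> p = - (q * eta).
Proof.
move=> e; apply: mul10_inj; rewrite mulrN mulrCA.
have -> : A 1 0 * eta = A 1 1 - mu.
  by have := lamD_mu; rewrite -eig_eta1 => h; lra.
by rewrite mulrBr [q * mu]mulrC -e; ring.
Qed.

Lemma det_eigmx : \det eigmx = xi + eta.
Proof. by rewrite det_mx2 !mx2E mulr1 mulr1 opprK. Qed.

Lemma eigmx_det_gt0 : 0 < xi + eta.
Proof. by rewrite addr_gt0 ?xi_gt0 ?eta_gt0. Qed.

Lemma eigmx_unit : eigmx \in unitmx.
Proof. by rewrite unitmxE unitfE det_eigmx gt_eqF // eigmx_det_gt0. Qed.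

Lemma mul_eigmx : A *m eigmx = eigmx *m mx2 lam 0 0 mu.
Proof.
have m0 : mu = A 0 0 + A 1 1 - lam by rewrite -lamD_mu; ring.
rewrite {1}(mx2_eta A) /eigmx !mul_mx2; congr mx2.
- by rewrite !mulr1 !mulr0 addr0 eig_xi0 mulrC.
- rewrite m0.
  have -> : xi * 0 + - eta * (A 0 0 + A 1 1 - lam)
    = - (A 0 0 * eta) - (A 1 1 * eta) + lam * eta by ring.
  by rewrite -eig_eta0; ring.
- by rewrite !mulr1 !mul1r addr0 eig_xi1.
- by rewrite m0 -eig_eta1; ring.
Qed.

(** The factor 2 compensates for the exponents [t / 2] in [a_t]: flowing for this time multiplies
    the expanding direction by [lam]. *)
Definition period : RR := 2 * ln lam.

Lemma period_gt0 : 0 < period.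
Proof. by rewrite mulr_gt0 // ln_gt0 // lam_gt1. Qed.

Lemma a_t_period : a_t period = mx2 lam 0 0 mu.
Proof.
have e : period / 2 = ln lam by rewrite /period; field.
by rewrite a_tE e expRN lnK ?posrE ?lam_gt0 // muE.
Qed.

Lemma mul_eigmx_a_t : A *m eigmx = eigmx *m a_t period.
Proof. by rewrite a_t_period mul_eigmx. Qed.

End Eigen.

(** Since [(B C) B = B (C B)], the matrix [B] carries eigenvectors of [C B] to eigenvectors of [B C]
    with the same eigenvalues, so the two eigenbases differ by a diagonal matrix. Its determinant is
    read off by comparing determinants. This moves the starting point of a cyclic word. *)
Lemma eigmx_rot (r : RR) (B C : 'M[RR]_2) :
  \det B = 1 -> (forall i j, 0 < B i j) ->
  balanced r (B *m C) -> balanced r (C *m B) ->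
  exists s1 s2, [/\ s1 = B 1 0 * xi (C *m B) + B 1 1,
    B *m eigmx (C *m B) = eigmx (B *m C) *m mx2 s1 0 0 s2 &
    s1 * s2 * (xi (B *m C) + eta (B *m C)) = xi (C *m B) + eta (C *m B)].
Proof.
move=> dB B0 bA bA'; set A := B *m C in bA *; set A' := C *m B in bA' *.
have trA : A 0 0 + A 1 1 = A' 0 0 + A' 1 1 by rewrite -!trace_mx2 mxtrace_mulC.
have dA : chdisc A = chdisc A' by rewrite /chdisc trA.
have el : lam A = lam A' by rewrite /lam trA dA.
have em : mu A = mu A' by rewrite /mu trA dA.
set s1 := B 1 0 * xi A' + B 1 1.
set s2 := B 1 1 - B 1 0 * eta A'.
have key : A *m (B *m eigmx A') = (B *m eigmx A') *m mx2 (lam A) 0 0 (mu A).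
  by rewrite el em -mulmxA -(mul_eigmx bA') /A /A' !mulmxA.
set E := B *m eigmx A' in key.
have e10 : E 1 0 = s1 by rewrite /E mulmx22E !mx2E mulr1.
have e11 : E 1 1 = s2 by rewrite /E mulmx22E !mx2E mulr1 /s2; ring.
have k0 : A 1 0 * E 0 0 + A 1 1 * E 1 0 = lam A * E 1 0.
  by rewrite -mulmx22E key mulmx22E !mx2E mulr0 addr0 mulrC.
have k1 : A 1 0 * E 0 1 + A 1 1 * E 1 1 = mu A * E 1 1.
  by rewrite -mulmx22E key mulmx22E !mx2E mulr0 add0r mulrC.
have e00 := eig_xi_unique bA k0.
have e01 := eig_eta_unique bA k1.
have eE : E = eigmx A *m mx2 s1 0 0 s2.
  apply: mx2P; rewrite mulmx22E !mx2E; rewrite ?e00 ?e01 ?e10 ?e11; ring.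
exists s1, s2; split => //.
have := congr1 determinant eE.
rewrite /E !det_mulmx dB !det_eigmx mul1r det_mx2 !mx2E mulr0 subr0 => ->.
by rewrite mulrC.
Qed.

(** * Compactness and discriminant *)

Lemma gamma_equiv_a_tMz (g : 'M[RR]_2) (T : RR) (z : int) :
  gamma_equiv g (g *m a_t T) -> gamma_equiv g (g *m a_t (z%:~R * T)).
Proof.
move=> gT.
have pos (n : nat) : gamma_equiv g (g *m a_t (n%:R * T)).
  elim: n => [|n IH]; first by rewrite mul0r a_t0 mulmx1; exact: gamma_equiv_refl.
  rewrite -natr1 mulrDl mul1r addrC a_tD mulmxA.
  by apply: gamma_equiv_trans IH _; exact: gamma_equivMr.
case: z => n; first exact: pos.
have := gamma_equivMr (a_t ((Negz n)%:~R * T)) (gamma_equiv_sym (pos n.+1)).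
by rewrite -mulmxA -a_tD NegzE mulrNz mulNr -pmulrn subrr a_t0 mulmx1.
Qed.

Lemma gamma_equiv_mod_period (g : 'M[RR]_2) (T t : RR) :
  0 < T -> gamma_equiv g (g *m a_t T) ->
  exists s, [/\ 0 <= s, s < T & gamma_equiv (g *m a_t s) (g *m a_t t)].
Proof.
move=> T0 gT; pose z := Num.floor (t / T); exists (t - z%:~R * T); split.
- by rewrite subr_ge0 -ler_pdivlMr // floor_le.
- rewrite ltrBlDr; have -> : T + z%:~R * T = (z + 1)%:~R * T by rewrite intrD; ring.
  by rewrite -ltr_pdivrMr // floorD1_gt.
- have := gamma_equivMr (a_t (t - z%:~R * T)) (gamma_equiv_a_tMz z gT).
  by rewrite -mulmxA -a_tD [_ + (t - _)]addrC subrK.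
Qed.

Lemma continuous_scaled_expR (R : realType) (a k : R) :
  continuous (fun t : R => a * expR (t * k)).
Proof.
move=> x; apply: cvgM; first exact: cvg_cst.
by apply: continuous_comp; [exact: mulrr_continuous|exact: continuous_expR].
Qed.

Lemma continuous_orbit (g : 'M[RR]_2) : continuous (fun t => g *m a_t t).
Proof.
move=> t; apply/cvg_ballP => e e0.
have h i j : \forall x \near t, ball ((g *m a_t t) i j) e ((g *m a_t x) i j).
  move: j; apply: ord2P.
  - have E x : (g *m a_t x) i 0 = g i 0 * expR (x * 2^-1).
      by rewrite mulmx22E a_tE !mx2E mulr0 addr0.
    rewrite E; apply: filterS (cvg_ball (@continuous_scaled_expR RR (g i 0) 2^-1 t) e0).
    by move=> x; rewrite E.
  - have E x : (g *m a_t x) i 1 = g i 1 * expR (x * - 2^-1).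
      by rewrite mulmx22E a_tE !mx2E mulr0 add0r mulrN.
    rewrite E; apply: filterS (cvg_ball (@continuous_scaled_expR RR (g i 1) (- 2^-1) t) e0).
    by move=> x; rewrite E.
near=> x; split => // i j; move: i j; do 2!apply: ord2P; near: x; exact: h.
Unshelve. all: by end_near.
Qed.

Lemma mem_In (T : eqType) (x : T) (s : seq T) : x \in s -> List.In x s.
Proof.
by elim: s => //= y s IH; rewrite inE => /orP[/eqP ->|/IH]; [left|right].
Qed.

(** The orbit is covered by the flow over the compact segment from 0 to [T]. Pulling an open cover
    back to the segment reduces the claim to the Heine-Borel theorem; saturation of the open sets
    then handles the other representatives. *)
Lemma periodic_orbit_of_period (g : 'M[RR]_2) (T : RR) :
  0 < T -> gamma_equiv g (g *m a_t T) -> periodic_orbit g.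
Proof.
move=> T0 gT I U oU cU.
have cpt := @segment_compact _ (0 : RR) T; rewrite compact_cover in cpt.
(* The index type is arbitrary; [{classic I}] equips it with the choice structure that the cover
   form of compactness asks for. *)
pose f (i : {classic I}) : set RR := [set t | U i (g *m a_t t)].
have of_ i : [set: {classic I}] i -> open (f i).
  move=> _; have [oUi _] := oU i.
  by apply: open_comp oUi => t _; exact: continuous_orbit.
have cf : [set` `[0 : RR, T]] `<=` cover [set: {classic I}] f.
  move=> t _; have [i Ui] := cU (g *m a_t t) (ex_intro _ t (gamma_equiv_refl _)).
  by exists i.
have [D _ DT] := cpt _ _ _ of_ cf.
exists (finmap.enum_fset D) => x [t tx].
have [s [s0 sT st]] := gamma_equiv_mod_period t T0 gT.
have sI : [set` `[0 : RR, T]] s by rewrite /= in_itv /= s0 ltW.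
have [i /= iD fi] := DT s sI.
have [_ [_ satU]] := oU i.
exists i; split; first exact: (@mem_In {classic I} i _ iD).
by apply: satU fi _; exact: gamma_equiv_trans st tx.
Qed.

(** In its eigenbasis [A] is a nonzero multiple of [Dh] plus a scalar, so modulo scalars [A] itself
    spans the conjugated Lie algebra. *)
Lemma in_Adh_eigmx (r : RR) (A X : 'M[RR]_2) : balanced r A ->
  in_Adh (eigmx A) X <-> exists s c : RR, X = s *: A + c%:M.
Proof.
move=> bA; set g := eigmx A.
have ug : g \in unitmx := eigmx_unit bA.
have lm : lam A - mu A != 0.
  have l1 := lam_gt1 bA; rewrite subr_eq0 gt_eqF // (muE bA).
  by apply: (lt_trans _ l1); rewrite invf_lt1 // (lt_trans _ l1).
pose k := (lam A - mu A) / 2; pose m := (lam A + mu A) / 2.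
have k0 : k != 0 by rewrite mulf_neq0 // invr_eq0 pnatr_eq0.
have AE : A = k *: (g *m Dh *m invmx g) + m%:M.
  rewrite -[LHS](mulmxK ug) (mul_eigmx bA).
  have -> : mx2 (lam A) 0 0 (mu A) = k *: Dh + m%:M.
    by apply: mx2P; rewrite !mxE /k /m /=; field.
  rewrite mulmxDr mulmxDl -scalemxAr -scalemxAl; congr (_ + _).
  by rewrite scalar_mxC -mulmxA mulmxV // mulmx1.
split=> -[s [c ->]].
- exists (s / k), (c - s / k * m); rewrite {1}AE scalerDr scalerA divfK //.
  rewrite -addrA; congr (_ + _).
  by rewrite scale_scalar_mx -raddfD /= addrC subrK.
- exists (s * k), (s * m + c); rewrite {1}AE scalerDr scalerA -addrA.
  by rewrite scale_scalar_mx -raddfD.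
Qed.

(** Left multiplication acts on each of the two columns as the matrix itself. *)
Lemma trLE (X : 'M[RR]_2) : trL X = 2 * \tr X.
Proof.
rewrite /trL /mxtrace (reindex _ (curry_mxvec_bij 2 2)) /=.
rewrite (eq_bigr (fun p : 'I_2 * 'I_2 => X p.1 p.1)).
  rewrite -(pair_bigA _ (fun i j : 'I_2 => X i i)) /= !sum_ord2; ring.
move=> [i j] _ /=; rewrite mxE /= vec_mx_delta mxvecE mxE.
rewrite (bigD1 i) //= mxE !eqxx mulr1 big1 ?addr0 // => k ki.
by rewrite mxE (negbTE ki) mulr0.
Qed.

(** The form is four times the discriminant of the characteristic polynomial. *)
Lemma BformE (X : 'M[RR]_2) :
  Bform X X = 4 * ((X 0 0 - X 1 1) ^+ 2 + 4 * (X 0 1 * X 1 0)).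
Proof.
by rewrite /Bform !trLE !trace_mx2 !mulmx22E !mxE /=; ring.
Qed.

(** Modulo scalars, [M] is [h] times a primitive integer matrix [e], where [h] is the gcd of the
    off-diagonal entries and the difference of the diagonal ones. Hence the discriminant is
    [4 * chdisc A / h^2], at most four times the squared trace. *)
Lemma exists_disc_le (r : RR) (M : 'M[int]_2) : balanced r (intmx M) ->
  exists d, is_disc (eigmx (intmx M)) d /\
            d <= 4 * (intmx M 0 0 + intmx M 1 1) ^+ 2.
Proof.
move=> bM; set A := intmx M in bM *.
pose p := M 0 1; pose q := M 1 0; pose w := M 1 1 - M 0 0.
pose h := gcdz (gcdz p q) w.
have p0 : 0 < p by have := bal_gt0 bM 0 1; rewrite intmxE ltr0z.
have q0 : 0 < q by have := bal_gt0 bM 1 0; rewrite intmxE ltr0z.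
have h0 : h != 0 by rewrite !gcdz_eq0 gt_eqF.
have hg : (h %| gcdz p q)%Z by exact: dvdz_gcdl.
have /dvdzP[p' pE] : (h %| p)%Z by apply: dvdz_trans hg (dvdz_gcdl _ _).
have /dvdzP[q' qE] : (h %| q)%Z by apply: dvdz_trans hg (dvdz_gcdr _ _).
have /dvdzP[w' wE] : (h %| w)%Z by exact: dvdz_gcdr.
have [u [v uv]] := Bezoutz p q.
have [y [z yz]] := Bezoutz (gcdz p q) w.
(* This integral linear form takes the value 1 on the entries of [e]; it serves below to show that a
   real multiple of [e] with integral entries is an integral multiple. *)
have bez : (y * u) * p' + (y * v) * q' + z * w' = 1.
  have hE : h = y * (u * p + v * q) + z * w by rewrite uv yz.
  apply: (mulIf h0); rewrite mul1r [RHS]hE pE qE wE; ring.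
pose e := mx2 0 p' q' w'.
have hR0 : (h%:~R : RR) != 0 by rewrite intr_eq0.
have AE : A = h%:~R *: intmx e + ((M 0 0)%:~R)%:M.
  rewrite /e intmx_mx2 scale_mx2 scalar_mx2 add_mx2; apply: mx2P; rewrite intmxE !mx2E.
  - by rewrite mulr0 add0r.
  - by rewrite addr0 -intrM mulrC -pE.
  - by rewrite addr0 -intrM mulrC -qE.
  - by rewrite -intrM mulrC -wE -intrD /w subrK.
exists (Bform (intmx e) (intmx e)); split.
  exists e; split; last split; last split => //.
  - apply/(in_Adh_eigmx _ bM); exists h%:~R^-1, (- (h%:~R^-1 * (M 0 0)%:~R)).
    rewrite {1}AE scalerDr scalerA mulVf // scale1r scale_scalar_mx -addrA -raddfD /=.
    by rewrite subrr raddf0 addr0.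
  - move=> [c]; rewrite /e intmx_mx2 scalar_mx2 => H.
    have [_ p'0 _ _] := mx2_inj H.
    have {}p'0 : p' = 0 by apply/eqP; rewrite -(intr_eq0 RR) p'0.
    by move: p0; rewrite pE p'0 mul0r ltxx.
  - move=> f /(in_Adh_eigmx _ bM)[s [c fE]].
    (* The Bezout form evaluated on [f] is the multiplier of [e]: it vanishes on scalars and is 1 on
       [e]. *)
    exists ((y * u) * f 0 1 + (y * v) * f 1 0 + z * (f 1 1 - f 0 0)), (s * (M 0 0)%:~R + c).
    have f2 : intmx f = (s * h%:~R) *: intmx e + (s * (M 0 0)%:~R + c)%:M.
      by rewrite fE AE scalerDr scalerA scale_scalar_mx -addrA -raddfD.
    rewrite {1}f2; congr (_ *: _ + _).
    have := f2; rewrite /e intmx_mx2 scale_mx2 scalar_mx2 add_mx2 (mx2_eta (intmx f)) !intmxE.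
    rewrite mulr0 add0r !addr0 => H.
    have [f00 f01 f10 f11] := mx2_inj H.
    rewrite !(intrB, intrD, intrM) f00 f01 f10 f11.
    have := congr1 (fun n : int => n%:~R : RR) bez.
    rewrite /= !(intrD, intrM) => bezR; rewrite -[LHS]mulr1 -[X in _ * X = _]bezR; ring.
have -> : 4 * (A 0 0 + A 1 1) ^+ 2 = 4 * chdisc A + 16 by rewrite /chdisc; ring.
have A01 : A 0 1 = p'%:~R * h%:~R by rewrite intmxE -/p pE intrM.
have A10 : A 1 0 = q'%:~R * h%:~R by rewrite intmxE -/q qE intrM.
have A11 : A 0 0 - A 1 1 = - (w'%:~R * h%:~R).
  by rewrite -intrM -wE !intmxE /w intrB opprB.
rewrite (chdiscE bM) A01 A10 A11 BformE /e intmx_mx2 !mx2E sub0r.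
have h1 : 1 <= (h%:~R : RR) ^+ 2.
  by rewrite -rmorphXn /= ler1z -gtz0_ge1 exprn_even_gt0.
have pq0 : 0 < (p'%:~R : RR) * q'%:~R.
  rewrite -intrM ltr0z -(pmulr_lgt0 _ (_ : 0 < h ^+ 2)) ?exprn_even_gt0 //.
  have -> : p' * q' * h ^+ 2 = p * q by rewrite pE qE; ring.
  exact: mulr_gt0.
have := sqr_ge0 (w'%:~R : RR).
nra.
Qed.

(** * Volume *)

(** Conjugating by [g] turns [a_t t] into [l] times an integer matrix, and determinants force [l] to
    be 1 or -1. The trace is thus an integer, which makes the set of return times discrete. *)
Lemma gamma_equiv_a_t_trace (g : 'M[RR]_2) (t : RR) : g \in unitmx ->
  gamma_equiv g (g *m a_t t) ->
  exists n : nat, expR (t / 2) + expR (- (t / 2)) = n%:R.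
Proof.
move=> ug [M [l [dM [l0 e]]]].
have g0 : \det g != 0 by rewrite -unitfE -unitmxE.
have d1 : l ^+ 2 * (\det M)%:~R = 1.
  apply: (mulIf g0); rewrite mul1r.
  have := congr1 determinant e; rewrite !det_mulmx det_a_t mulr1 => {2}->.
  by rewrite detZ det_mulmx det_intmx mulrA.
have l1 : l ^+ 2 = 1.
  case: dM d1 => -> ; first by rewrite mulr1.
  by rewrite mulrN1 => h; have := sqr_ge0 l; lra.
have tE : expR (t / 2) + expR (- (t / 2)) = l * (\tr M)%:~R.
  have -> : expR (t / 2) + expR (- (t / 2)) = \tr (a_t t).
    by rewrite a_tE trace_mx2 !mx2E.
  have -> : a_t t = invmx g *m (l *: (intmx M *m g)) by rewrite -e mulKmx.
  by rewrite mxtrace_mulC -scalemxAl mulmxK // mxtraceZ !trace_mx2 !intmxE intrD.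
have [k kE] : exists k : int, expR (t / 2) + expR (- (t / 2)) = k%:~R.
  move: l1; move=> /eqP; rewrite sqrf_eq1 => /orP[] /eqP l1.
  - by exists (\tr M); rewrite tE l1 mul1r.
  - by exists (- \tr M); rewrite tE l1 mulN1r intrN.
have k0 : 0 <= k by rewrite -(ler0z RR) -kE addr_ge0 // expR_ge0.
by exists `|k|%N; rewrite kE pmulrn gez0_abs.
Qed.

Lemma two_cosh_lt (s t : RR) : 0 < s -> s < t ->
  expR (s / 2) + expR (- (s / 2)) < expR (t / 2) + expR (- (t / 2)).
Proof.
move=> s0 st; rewrite !expRN.
have x1 : 1 < expR (s / 2) by rewrite expR_gt1 divr_gt0.
have xy : expR (s / 2) < expR (t / 2) by rewrite ltr_expR ltr_pM2r.
move: (expR (s / 2)) (expR (t / 2)) x1 xy => x y x1 xy.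
have y1 := lt_trans x1 xy.
rewrite -subr_gt0.
have -> : y + y^-1 - (x + x^-1) = (y - x) * (1 - (x * y)^-1).
  by field; rewrite !gt_eqF //; lra.
rewrite mulr_gt0 ?subr_gt0 // invf_lt1; last by rewrite mulr_gt0; lra.
by rewrite -[1]mulr1 ltr_pM //; lra.
Qed.

(** The trace increases with the time, so the least natural number attained as a trace at a positive
    return time yields the least period. The uniform lower bound later absorbs the rounding in the
    count of unit time windows. *)
Lemma exists_is_vol (g : 'M[RR]_2) (T : RR) : g \in unitmx -> 0 < T ->
  gamma_equiv g (g *m a_t T) -> exists v, is_vol g v /\ 2 * ln 2 <= v.
Proof.
move=> ug T0 gT.
pose P (n : nat) := exists t, [/\ 0 < t, gamma_equiv g (g *m a_t t) &
  expR (t / 2) + expR (- (t / 2)) = n%:R].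
have exP : exists n, `[< P n >].
  by have [n nE] := gamma_equiv_a_t_trace ug gT; exists n; apply/asboolP; exists T.
case: (ex_minnP exP) => n /asboolP[v [v0 gv vE]] nmin.
exists v; split; first split => //; first split => //.
  move=> t t0 tv gt.
  have [m mE] := gamma_equiv_a_t_trace ug gt.
  have : (n <= m)%N by apply: nmin; apply/asboolP; exists t.
  by rewrite -(ler_nat RR) -mE -vE leNgt two_cosh_lt.
have x1 : 1 < expR (v / 2) by rewrite expR_gt1 divr_gt0.
(* The trace [x + 1/x] exceeds 2 and is an integer, hence at least 3; as [1/x <= 1], this gives
   [x >= 2]. *)
have n3 : (3 <= n)%N.
  rewrite ltnNge -(ler_nat RR) -vE -ltNge expRN.
  move: (expR (v / 2)) x1 => x x1.
  rewrite -subr_gt0.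
  have -> : x + x^-1 - 2 = (x - 1) ^+ 2 / x by field; rewrite gt_eqF //; lra.
  by rewrite divr_gt0 // ?exprn_gt0; lra.
rewrite -(ler_nat RR) -vE in n3.
have xi1 : expR (- (v / 2)) <= 1.
  by rewrite expRN invf_le1 ?expR_gt0 // ltW.
have x2 : 2 <= expR (v / 2) by lra.
have : ln 2 <= v / 2.
  by rewrite -[leRHS]expRK ler_ln // posrE ?expR_gt0.
by lra.
Qed.

Lemma gamma_equiv_period (r : RR) (M : 'M[int]_2) :
  balanced r (intmx M) -> \det M = 1 ->
  gamma_equiv (eigmx (intmx M)) (eigmx (intmx M) *m a_t (period (intmx M))).
Proof.
move=> bM dM; exists M, 1; split; [by left|split; first exact: oner_neq0].
by rewrite scale1r (mul_eigmx_a_t bM).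
Qed.

(** * The sets [in_Omega'] along an orbit *)

Lemma in_Omega'_gamma_equiv (delta : RR) (g h : 'M[RR]_2) :
  gamma_equiv g h -> in_Omega' delta g -> in_Omega' delta h.
Proof.
move=> [M [l [dM [l0 ->]]]] gO m m0.
have uM : M \in unitmx by rewrite unitmxE; case: dM => ->.
have mM : m *m M != 0.
  by apply: contra m0 => /eqP h0; rewrite -[m](mulmxK uM) h0 mul0mx.
have := gO _ mM.
have dM1 : `|(\det M)%:~R : RR| = 1 by case: dM => ->; rewrite ?normrN1 ?normr1.
rewrite detZ normrM normrX det_mulmx det_intmx [`|_%:~R * _|]normrM dM1 mul1r.
rewrite -scalemxAr mulmxA /intmx -map_mxM.
set u := map_mx _ _ *m g => hu.
have -> : normInf (l *: u) = `|l| * normInf u.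
  by rewrite /normInf !mxE !normrM maxr_pMr.
by rewrite exprMn mulrCA ler_pM2l // exprn_gt0 // normr_gt0.
Qed.

(** The flow leaves the product of the two coordinates of [m g] unchanged, and the square of the sup
    norm is at least the absolute value of that product. *)
Lemma in_Omega'_a_t (delta : RR) (g : 'M[RR]_2) :
  (forall m : 'rV[int]_2, m != 0 ->
     delta * `|\det g| <= `|((m 0 0)%:~R * g 0 0 + (m 0 1)%:~R * g 1 0)
                          * ((m 0 0)%:~R * g 0 1 + (m 0 1)%:~R * g 1 1)|) ->
  forall x, orbitset g x -> in_Omega' delta x.
Proof.
move=> H x [t gx]; apply: in_Omega'_gamma_equiv gx _ => m m0.
rewrite det_mulmx det_a_t mulr1; apply: le_trans (H m m0) _.
set v := map_mx _ m; rewrite mulmxA.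
rewrite /normInf !mulmx22E a_tE !mx2E !mulr0 addr0 add0r.
have -> : (m 0 0)%:~R * g 0 0 + (m 0 1)%:~R * g 1 0 = v 0 0 * g 0 0 + v 0 1 * g 1 0.
  by rewrite !mxE.
have -> : (m 0 0)%:~R * g 0 1 + (m 0 1)%:~R * g 1 1 = v 0 0 * g 0 1 + v 0 1 * g 1 1.
  by rewrite !mxE.
move: (v 0 0 * g 0 0 + _) (v 0 0 * g 0 1 + _) => X Y.
have -> : X * Y = (X * expR (t / 2)) * (Y * expR (- (t / 2))).
  by rewrite mulrACA -exp.expRD subrr exp.expR0 mulr1.
rewrite normrM expr2; apply: ler_pM; rewrite ?normr_ge0 // le_max lexx ?orbT //.
Qed.

(** * Words in a separated code *)

Lemma expr_unbounded (l c : RR) : 1 < l -> exists n, c < l ^+ n.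
Proof.
move=> l1; exists (Num.bound `|c / (l - 1)|).
have bern n : n%:R * (l - 1) < l ^+ n.
  have : 1 + n%:R * (l - 1) <= l ^+ n; last by lra.
  elim: n => [|n IH]; first by rewrite mul0r addr0 expr0.
  rewrite exprS -natr1; have := ler_wpM2l (_ : 0 <= l) IH => h.
  apply: le_trans (h _); last by lra.
  have : 0 <= n%:R * ((l - 1) * (l - 1)) :> RR.
    by rewrite mulr_ge0 // mulr_ge0 //; lra.
  by lra.
apply: lt_trans (bern _); rewrite -ltr_pdivrMr; last by lra.
exact: le_lt_trans (ler_norm _) (archi_boundP (normr_ge0 _)).
Qed.

(* [code_sep] makes the cones [B i (R_{>=0}^2)] disjoint, so that the [B i] freely
   generate a semigroup. *)
Record separated_code (I : Type) (r : nat) (B : I -> 'M[int]_2) : Prop := SeparatedCode {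
  code_entry : forall i x y, 1 <= B i x y /\ B i x y <= r%:Z;
  code_det : forall i, \det (B i) = 1;
  code_sep : forall i j (u v : 'cV[int]_2), u != 0 ->
    (forall x, 0 <= u x 0) -> (forall x, 0 <= v x 0) ->
    B i *m u = B j *m v -> i = j }.

Definition wprod (I : Type) (B : I -> 'M[int]_2) (w : seq I) : 'M[int]_2 :=
  foldr (fun i A => B i *m A) 1%:M w.

Definition wmx (I : Type) (B : I -> 'M[int]_2) (w : seq I) : 'M[RR]_2 := intmx (wprod B w).

Section Words.
Variables (I : eqType) (r : nat) (B : I -> 'M[int]_2).
Hypothesis hB : separated_code r B.
Hypothesis r1 : (1 <= r)%N.
Implicit Types (i : I) (u v w : seq I) (m : 'rV[int]_2).

Local Notation P := (wprod B).
Local Notation A := (wmx B).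
Local Notation rR := (r%:R : RR).

Lemma wprod_cat u v : P (u ++ v) = P u *m P v.
Proof. by elim: u => [|i u IH] /=; rewrite ?mul1mx // IH mulmxA. Qed.

Lemma wprod_rcons (s : seq I) i : P (rcons s i) = P s *m B i.
Proof. by rewrite -cats1 wprod_cat /= mulmx1. Qed.

Lemma det_wprod w : \det (P w) = 1.
Proof.
by elim: w => [|i w IH] /=; rewrite ?det1 // det_mulmx IH (code_det hB) mulr1.
Qed.

Lemma wprod_unit w : P w \in unitmx.
Proof. by rewrite unitmxE det_wprod. Qed.

Lemma wprod_ge0 w x y : 0 <= P w x y.
Proof.
elim: w x y => [|i w IH] x y /=; first by rewrite mxE; case: (_ == _).
rewrite mulmx22E; have h z : 0 <= B i x z.
  by have [h _] := code_entry hB i x z; apply: le_trans h.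
by rewrite addr_ge0 // mulr_ge0.
Qed.

(** The first letter is recovered from the cone that contains the first column of the product; it is
    then cancelled and the argument is repeated. *)
Lemma wprod_inj u v : size u = size v -> P u = P v -> u = v.
Proof.
elim: u v => [|i u IH] [|j v] //= [su] e.
have ij : i = j.
  apply: (code_sep hB (u := col 0 (P u)) (v := col 0 (P v))).
  - apply/eqP => /matrixP h.
    have := det_wprod u; rewrite det_mx2.
    have := h 0 0; rewrite !mxE => ->; have := h 1 0; rewrite !mxE => ->.
    by rewrite mul0r mulr0 subr0 => /eqP; rewrite eq_sym oner_eq0.
  - by move=> x; rewrite mxE wprod_ge0.
  - by move=> x; rewrite mxE wprod_ge0.
  - have h k (U : 'M[int]_2) : B k *m col 0 U = col 0 (B k *m U).
      by apply/matrixP => x y; rewrite !mxE; apply: eq_bigr => z _; rewrite mxE.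
    by rewrite !h e.
rewrite ij in e *; congr (_ :: _); apply: IH => //.
have uB : B j \in unitmx by rewrite unitmxE (code_det hB).
by rewrite -[P u](mulKmx uB) e mulKmx.
Qed.

Lemma code_intmx i x y : 1 <= intmx (B i) x y /\ intmx (B i) x y <= rR.
Proof.
have [h1 h2] := code_entry hB i x y.
by rewrite intmxE ler1z; split => //; rewrite -[rR]/(r%:Z%:~R) ler_int.
Qed.

Lemma rR_ge1 : 1 <= rR.
Proof. by rewrite ler1n. Qed.

Lemma wmx_cons i w : A (i :: w) = intmx (B i) *m A w.
Proof. exact: intmxM. Qed.

Lemma wmx_det w : \det (A w) = 1.
Proof. by rewrite det_intmx det_wprod. Qed.

Lemma code_mul_le i (a b : RR) z z' : 0 <= a -> 0 <= b ->
  intmx (B i) z 0 * a + intmx (B i) z 1 * b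
  <= rR * (intmx (B i) z' 0 * a + intmx (B i) z' 1 * b).
Proof.
move=> a0 b0; have h k : intmx (B i) z k <= rR * intmx (B i) z' k.
  have [_ h1] := code_intmx i z k; have [h2 _] := code_intmx i z' k.
  by apply: le_trans h1 _; rewrite ler_peMr // (le_trans ler01 rR_ge1).
by rewrite mulrDr !mulrA lerD // ler_wpM2r.
Qed.

(** In a product the comparability of rows comes from the tail and that of columns from the first
    letter, so the constant stays [r] for every length. *)
Lemma balanced_wmx w : w != [::] -> balanced rR (A w).
Proof.
elim: w => [//|i w IH] _.
have [->|w0] := eqVneq w [::].
  have e : A [:: i] = intmx (B i) by rewrite /wmx /= mulmx1.
  have h x y z t : A [:: i] x y <= rR * A [:: i] z t.
    have [_ h1] := code_intmx i x y; have [h2 _] := code_intmx i z t.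
    by rewrite e; apply: le_trans h1 _; rewrite ler_peMr // (le_trans ler01 rR_ge1).
  split => //.
  - by move=> x y; rewrite e; have [h1 _] := code_intmx i x y; apply: lt_le_trans h1.
  - by rewrite -det_mx2 wmx_det.
have bw := IH w0.
have Bp x y : 0 < intmx (B i) x y.
  by have [h1 _] := code_intmx i x y; apply: lt_le_trans h1.
split.
- by move=> x y; rewrite wmx_cons mulmx22E addr_gt0 // mulr_gt0 // (bal_gt0 bw).
- by rewrite -det_mx2 wmx_det.
- move=> x y y'; rewrite wmx_cons !mulmx22E mulrDr mulrCA [rR * (_ * A w 1 _)]mulrCA.
  by rewrite lerD // ler_pM2l // (bal_row bw).
- by move=> x y y'; rewrite wmx_cons !mulmx22E; apply: code_mul_le; apply: ltW; apply: (bal_gt0 bw).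
Qed.

Lemma wmx_le w x y : A w x y <= (2 * rR) ^+ size w.
Proof.
elim: w x y => [|i w IH] x y /=.
  by rewrite /wmx intmx1 expr0 mxE; case: (_ == _); rewrite ?lexx ?ler01.
rewrite wmx_cons mulmx22E exprS.
have h z : intmx (B i) x z * A w z y <= rR * (2 * rR) ^+ size w.
  have [h1 h2] := code_intmx i x z.
  apply: ler_pM => //; first exact: le_trans h1.
  by rewrite intmxE ler0z wprod_ge0.
by have := h 0; have := h 1; lra.
Qed.

Definition wg w : 'M[RR]_2 := eigmx (A w).
(** The product of the two coordinates is an indefinite binary quadratic form in [m]; bounding it
    below on nonzero integer vectors is what [in_Omega'_a_t] asks for. *)
Definition ev w m : 'rV[RR]_2 := map_mx intr m *m wg w.

Lemma ev0E w m : ev w m 0 0 = (m 0 0)%:~R * xi (A w) + (m 0 1)%:~R.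
Proof. by rewrite /ev mulmx22E !mxE /= mulr1. Qed.

Lemma ev1E w m : ev w m 0 1 = (m 0 1)%:~R - (m 0 0)%:~R * eta (A w).
Proof. by rewrite /ev mulmx22E !mxE /= mulr1 mulrN addrC. Qed.

(** A nonzero integer vector cannot be small in both coordinates: their difference is [m 0 0] times
    [xi + eta], which is at least [2 / r], and when [m 0 0 = 0] the first coordinate is a nonzero
    integer. *)
Lemma ev_max w m : w != [::] -> m != 0 ->
  1 <= rR * `|ev w m 0 0| \/ 1 <= rR * `|ev w m 0 1|.
Proof.
move=> w0 m0; have bw := balanced_wmx w0.
have R1 := rR_ge1.
have [x0|x0] := eqVneq (m 0 0) 0.
  left; rewrite ev0E x0 mul0r add0r.
  have y0 : m 0 1 != 0.
    apply: contra m0 => /eqP y0; apply/eqP/matrixP => i j.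
    by rewrite ord1 mxE; move: j; apply: ord2P.
  have : 1 <= `|(m 0 1)%:~R : RR| by rewrite -intr_norm ler1z -gtz0_ge1 normr_gt0.
  by move=> h; apply: le_trans h _; rewrite ler_peMl ?normr_ge0.
have x1 : 1 <= `|(m 0 0)%:~R : RR| by rewrite -intr_norm ler1z -gtz0_ge1 normr_gt0.
have e : (m 0 0)%:~R * (xi (A w) + eta (A w)) = ev w m 0 0 - ev w m 0 1.
  by rewrite ev0E ev1E; ring.
have d0 := eigmx_det_gt0 bw.
have h : xi (A w) + eta (A w) <= `|ev w m 0 0| + `|ev w m 0 1|.
  apply: le_trans (ler_normB _ _); rewrite -e normrM [`|xi _ + _|]gtr0_norm //.
  by rewrite ler_peMl // ltW.
have h2 : 2 <= rR * `|ev w m 0 0| + rR * `|ev w m 0 1|.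
  rewrite -mulrDr; apply: le_trans (ler_wpM2l _ h); last by lra.
  by have := xi_geVr bw; have := eta_geVr bw; rewrite mulrDr; lra.
case: (lerP 1 (rR * `|ev w m 0 0|)) => [|h3]; [by left|right; lra].
Qed.

(** This is [eigmx_rot] for a single letter. The bounds on [s1] come from the entries of the letter
    and from [xi <= r], while [s2] is controlled through the determinant identity. *)
Lemma ev_rot i (s : seq I) m : exists s1 s2, [/\ 1 <= s1, s1 <= 2 * rR ^+ 2,
  ev (rcons s i) (m *m B i) 0 0 = ev (i :: s) m 0 0 * s1,
  ev (rcons s i) (m *m B i) 0 1 = ev (i :: s) m 0 1 * s2 &
  s1 * s2 * (xi (A (i :: s)) + eta (A (i :: s))) =
    xi (A (rcons s i)) + eta (A (rcons s i))].
Proof.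
have b1 : balanced rR (A (i :: s)) by exact: balanced_wmx.
have b2 : balanced rR (A (rcons s i)) by apply: balanced_wmx; rewrite -size_eq0 size_rcons.
have e1 : A (i :: s) = intmx (B i) *m A s by exact: wmx_cons.
have e2 : A (rcons s i) = A s *m intmx (B i) by rewrite /wmx wprod_rcons intmxM.
have [] := @eigmx_rot rR (intmx (B i)) (A s).
- by rewrite det_intmx (code_det hB).
- by move=> x y; have [h _] := code_intmx i x y; apply: lt_le_trans h.
- by rewrite -e1.
- by rewrite -e2.
rewrite -e1 -e2 => s1 [s2 [s1E gE dE]]; exists s1, s2.
have [h10 h10'] := code_intmx i 1 0; have [h11 h11'] := code_intmx i 1 1.
have x0 := xi_gt0 b2; have xr := xi_ler b2; have R1 := rR_ge1.
have evE : ev (rcons s i) (m *m B i) = ev (i :: s) m *m mx2 s1 0 0 s2.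
  by rewrite /ev /wg map_mxM -mulmxA -[map_mx _ (B i)]/(intmx (B i)) gE mulmxA.
split => //.
- by rewrite s1E -[1]add0r lerD // mulr_ge0 ?ltW // (lt_le_trans _ h10).
- rewrite s1E; have : intmx (B i) 1 0 * xi (A (rcons s i)) <= rR * rR.
    by apply: ler_pM => //; [exact: le_trans h10|exact: ltW].
  rewrite expr2; have : rR <= rR * rR by rewrite ler_peMr //; lra.
  by lra.
- by rewrite evE mulmx22E !mx2E mulr0 addr0.
- by rewrite evE mulmx22E !mx2E mulr0 add0r.
Qed.

Lemma ev_ge_of_le w m : w != [::] -> m != 0 -> 0 < rR ->
  `|ev w m 0 1| <= `|ev w m 0 0| -> 1 <= rR * `|ev w m 0 0|.
Proof.
move=> w0 m0 R0 h; have [//|h1] := ev_max w0 m0.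
by apply: le_trans h1 _; rewrite ler_pM2l.
Qed.

Lemma mulmx_neq0 m (M : 'M[int]_2) : M \in unitmx -> m != 0 -> m *m M != 0.
Proof.
by move=> uM; apply: contra => /eqP h; rewrite -[m](mulmxK uM) h mul0mx.
Qed.

(* Along a rotation of the word, the ratio of the coordinates of [m] in the eigenbasis
   changes by a bounded factor at each letter, so at a crossing both coordinates
   are bounded below. *)
Lemma ev_crossing u v m : u ++ v != [::] -> m != 0 ->
  `|ev (u ++ v) m 0 0| <= `|ev (u ++ v) m 0 1| ->
  `|ev (v ++ u) (m *m P u) 0 1| <= `|ev (v ++ u) (m *m P u) 0 0| ->
  xi (A (u ++ v)) + eta (A (u ++ v))
    <= 8 * rR ^+ 7 * `|ev (u ++ v) m 0 0 * ev (u ++ v) m 0 1|.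
Proof.
have R1 := rR_ge1; have R0 : 0 < rR by lra.
have Rn a b : (a <= b)%N -> rR ^+ a <= rR ^+ b by move=> ab; exact: ler_weXn2l.
elim: u v m => [|i u IH] v m uv0 m0 h1 h2.
  rewrite cats0 mulmx1 /= in h2; rewrite /= in uv0 h1 *.
  have bw := balanced_wmx uv0.
  have h3 := ev_ge_of_le uv0 m0 R0 h2.
  have e : `|ev v m 0 0| = `|ev v m 0 1| by apply/eqP; rewrite eq_le h1 h2.
  rewrite normrM -e.
  have h4 : 1 <= (rR * `|ev v m 0 0|) ^+ 2 by exact: exprn_ege1.
  have h5 : xi (A v) + eta (A v) <= 2 * rR.
    by have := xi_ler bw; have := eta_ler bw; lra.
  apply: le_trans h5 _.
  have -> : 8 * rR ^+ 7 * (`|ev v m 0 0| * `|ev v m 0 0|) =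
    (8 * rR ^+ 5) * (rR * `|ev v m 0 0|) ^+ 2 by ring.
  have h6 : 2 * rR <= 8 * rR ^+ 5.
    by have := Rn 1%N 5%N isT; rewrite expr1; lra.
  apply: le_trans h6 _; rewrite ler_peMr // mulr_ge0 // exprn_ge0 //; lra.
have [s1 [s2 [s1_ge1 s1_le eX eY eD]]] := ev_rot i (u ++ v) m.
have E1 : rcons (u ++ v) i = u ++ rcons v i by rewrite rcons_cat.
rewrite E1 in eX eY eD.
have uB : B i \in unitmx by rewrite unitmxE (code_det hB).
have mB0 : m *m B i != 0 by exact: mulmx_neq0.
have uv1 : u ++ rcons v i != [::] by rewrite -size_eq0 size_cat size_rcons addnS.
have b0 := balanced_wmx uv0; have b1 := balanced_wmx uv1.
have D0 := eigmx_det_gt0 b0; have D1 := eigmx_det_gt0 b1.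
have s12 : 0 < s1 * s2 by rewrite -(pmulr_lgt0 _ D0) eD.
have s20 : 0 < s2 by rewrite -(pmulr_rgt0 _ (_ : 0 < s1)) //; lra.
rewrite [(i :: u) ++ v]/= in h1 D0 b0 *.
(* Both sides of the claim for the rotated word are [s1 * s2] times those for the original word. *)
suff main : xi (A (u ++ rcons v i)) + eta (A (u ++ rcons v i))
    <= 8 * rR ^+ 7 * `|ev (u ++ rcons v i) (m *m B i) 0 0 * ev (u ++ rcons v i) (m *m B i) 0 1|.
  rewrite -(ler_pM2l s12) eD; apply: le_trans main _.
  rewrite eX eY !normrM (gtr0_norm s20) [`|s1|]gtr0_norm; last by lra.
  by rewrite le_eqVlt; apply/orP; left; apply/eqP; ring.
case: (lerP `|ev (u ++ rcons v i) (m *m B i) 0 0| `|ev (u ++ rcons v i) (m *m B i) 0 1|) => h3.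
  apply: IH => //.
  by move: h2; rewrite /= cat_rcons mulmxA.
(* Here the order of the coordinates switches exactly at the letter [i]. *)
have h4 := ev_ge_of_le uv1 mB0 R0 (ltW h3).
have h5 : s2 * `|ev (u ++ rcons v i) (m *m B i) 0 0| <= s1 * `|ev (u ++ rcons v i) (m *m B i) 0 1|.
  rewrite eX eY !normrM (gtr0_norm s20) [`|s1|]gtr0_norm; last by lra.
  have -> (a : RR) : s2 * (a * s1) = s1 * s2 * a by ring.
  have -> (a : RR) : s1 * (a * s2) = s1 * s2 * a by ring.
  by rewrite ler_pM2l.
rewrite normrM.
move: `|ev _ _ 0 0| `|ev _ _ 0 1| h4 h5 (normr_ge0 (ev (u ++ rcons v i) (m *m B i) 0 1)) => X Y h4 h5 Y0.
have hD : xi (A (i :: u ++ v)) + eta (A (i :: u ++ v)) <= 2 * rR.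
  by have := xi_ler b0; have := eta_ler b0; lra.
set D := xi (A (i :: _)) + _ in D0 eD hD.
rewrite -eD.
(* The bound is [(2 r^2)^2] from [s1] times [2 r] from [D]. The remaining [r^2] in the final
   constant comes from the square of [1 <= r X]. *)
have s1D : s1 * s1 * D <= 8 * rR ^+ 5.
  have : s1 * s1 <= (2 * rR ^+ 2) * (2 * rR ^+ 2) by apply: ler_pM => //; lra.
  move=> h; have -> : 8 * rR ^+ 5 = (2 * rR ^+ 2) * (2 * rR ^+ 2) * (2 * rR) by ring.
  apply: ler_pM => //; last exact: ltW.
  by rewrite mulr_ge0; lra.
have X0 : 0 < X by rewrite -(pmulr_rgt0 _ R0); lra.
have h6 : s1 * s2 * D * X <= 8 * rR ^+ 5 * Y.
  have : s1 * D * (s2 * X) <= s1 * D * (s1 * Y).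
    by rewrite ler_pM2l // mulr_gt0 //; lra.
  have : s1 * s1 * D * Y <= 8 * rR ^+ 5 * Y by rewrite ler_wpM2r.
  have -> : s1 * D * (s2 * X) = s1 * s2 * D * X by ring.
  have -> : s1 * D * (s1 * Y) = s1 * s1 * D * Y by ring.
  lra.
have h7 : 1 <= (rR * X) ^+ 2 by exact: exprn_ege1.
have -> : 8 * rR ^+ 7 * (X * Y) = (rR ^+ 2 * X) * (8 * rR ^+ 5 * Y) by ring.
have h8 : (rR ^+ 2 * X) * (s1 * s2 * D * X) <= (rR ^+ 2 * X) * (8 * rR ^+ 5 * Y).
  by rewrite ler_pM2l // mulr_gt0 // exprn_gt0.
apply: le_trans h8.
have -> : rR ^+ 2 * X * (s1 * s2 * D * X) = (s1 * s2 * D) * (rR * X) ^+ 2 by ring.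
by rewrite ler_peMr // ltW // mulr_gt0.
Qed.

Lemma ev_period w m : w != [::] ->
  ev w (m *m P w) 0 0 = lam (A w) * ev w m 0 0 /\
  ev w (m *m P w) 0 1 = (lam (A w))^-1 * ev w m 0 1.
Proof.
move=> w0; have bw := balanced_wmx w0.
have evE : ev w (m *m P w) = ev w m *m mx2 (lam (A w)) 0 0 (mu (A w)).
  rewrite /ev /wg map_mxM -mulmxA -[map_mx _ (P w)]/(A w) (mul_eigmx bw).
  by rewrite mulmxA.
by rewrite evE !mulmx22E !mx2E !mulr0 addr0 add0r -(muE bw) mulrC [mu _ * _]mulrC.
Qed.

Lemma ev_iter w m n : w != [::] ->
  ev w (iter n (mulmxr (P w)) m) 0 0 = lam (A w) ^+ n * ev w m 0 0 /\
  ev w (iter n (mulmxr (P w)) m) 0 1 = (lam (A w))^-1 ^+ n * ev w m 0 1.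
Proof.
move=> w0; elim: n => [|n [IH1 IH2]]; first by rewrite !expr0 !mul1r.
have [e1 e2] := ev_period (iter n (mulmxr (P w)) m) w0.
by rewrite iterS e1 e2 IH1 IH2 !exprS !mulrA.
Qed.

Lemma iter_mulmx_neq0 w m n : m != 0 -> iter n (mulmxr (P w)) m != 0.
Proof.
by move=> m0; elim: n => [//|n IH]; rewrite iterS /= mulmx_neq0 ?wprod_unit.
Qed.

(** Multiplying [m] by [P w] preserves the product of the coordinates while the first grows and the
    second shrinks. Some translate therefore has its crossing within one period, where [ev_crossing]
    applies. *)
Lemma ev_mul_ge w m : w != [::] -> m != 0 ->
  xi (A w) + eta (A w) <= 8 * rR ^+ 7 * `|ev w m 0 0 * ev w m 0 1|.
Proof.
move=> w0 m0; have bw := balanced_wmx w0.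
have l1 := lam_gt1 bw; have R1 := rR_ge1.
have l0 : 0 < lam (A w) by lra.
have R0 : 0 < rR by lra.
have inv k n : ev w (iter n (mulmxr (P w)) k) 0 0 * ev w (iter n (mulmxr (P w)) k) 0 1
    = ev w k 0 0 * ev w k 0 1.
  have [-> ->] := ev_iter k n w0.
  by rewrite mulrACA exprVn divff ?mul1r // expf_neq0 // gt_eqF.
(* translate [m] backwards until its expanding coordinate is the small one *)
have [k [n [k0 kn kle]]] : exists k n, [/\ k != 0, iter n (mulmxr (P w)) k = m &
    `|ev w k 0 0| <= `|ev w k 0 1|].
  have [n hn] := expr_unbounded (rR * `|ev w m 0 0|) l1.
  pose k := iter n (mulmxr (invmx (P w))) m.
  have kn : iter n (mulmxr (P w)) k = m.
    rewrite /k; elim: n {hn k} => [//|n IH].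
    by rewrite iterSr iterS /= mulmxKV ?wprod_unit.
  have k0 : k != 0.
    by apply: contra m0 => /eqP h; rewrite -kn h; elim: n {hn k kn h} => //= n /eqP ->; rewrite mul0mx.
  exists k, n; split => //.
  have [e1 e2] := ev_iter k n w0; rewrite kn in e1.
  rewrite e1 normrM gtr0_norm ?exprn_gt0 // in hn.
  have hn' : rR * `|ev w k 0 0| < 1.
    by rewrite -(ltr_pM2l (exprn_gt0 n l0)) mulr1 mulrCA.
  have [|h] := ev_max w0 k0; first by rewrite leNgt hn'.
  by rewrite -(ler_pM2l R0); lra.
have [p hp] : exists p, `|ev w (iter p (mulmxr (P w)) k) 0 1|
                        <= `|ev w (iter p (mulmxr (P w)) k) 0 0|.
  have [p hp] := expr_unbounded (rR * `|ev w k 0 1|) l1; exists p.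
  have [e1 e2] := ev_iter k p w0.
  have hp' : rR * `|ev w (iter p (mulmxr (P w)) k) 0 1| < 1.
    rewrite e2 normrM gtr0_norm ?exprn_gt0 ?invr_gt0 // exprVn mulrCA.
    by rewrite mulrC ltr_pdivrMr ?exprn_gt0 // mul1r.
  have [h|] := ev_max w0 (iter_mulmx_neq0 w p k0); last by rewrite leNgt hp'.
  by rewrite -(ler_pM2l R0); lra.
have exP : exists p, `|ev w (iter p (mulmxr (P w)) k) 0 1|
                        <= `|ev w (iter p (mulmxr (P w)) k) 0 0| by exists p.
rewrite -kn inv.
(* If the minimum is 0, both orders hold at once and the empty prefix suffices. Otherwise the
   crossing happens during the last period, and the whole word is taken as prefix. *)
case: (ex_minnP exP) => -[|q] hq qmin.
  have := @ev_crossing [::] w k w0 k0 kle; rewrite cats0 mulmx1; exact.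
have q0 := iter_mulmx_neq0 w q k0.
have hlt : `|ev w (iter q (mulmxr (P w)) k) 0 0| <= `|ev w (iter q (mulmxr (P w)) k) 0 1|.
  by rewrite leNgt; apply/negP => /ltW /qmin; rewrite ltnn.
have := @ev_crossing w [::] (iter q (mulmxr (P w)) k).
by rewrite cats0 inv; apply.
Qed.

Lemma orbit_in_Omega' w x : w != [::] -> orbitset (wg w) x ->
  in_Omega' (8 * rR ^+ 7)^-1 x.
Proof.
move=> w0; apply: in_Omega'_a_t => m m0.
have bw := balanced_wmx w0.
have R0 : 0 < 8 * rR ^+ 7 by rewrite mulr_gt0 // exprn_gt0 // (lt_le_trans _ rR_ge1).
rewrite det_eigmx gtr0_norm ?(eigmx_det_gt0 bw) // mulrC ler_pdivrMr // mulrC.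
have := ev_mul_ge w0 m0; rewrite /ev !mulmx22E !mxE.
by [].
Qed.

End Words.

(** * Multiplicity of an orbit *)

Lemma card_le_fibers (T J : finType) (S : {set T}) (b : T -> J) (K : nat) :
  (forall j, (#|[set x in S | b x == j]%SET| <= K)%N) -> (#|S| <= #|J| * K)%N.
Proof.
move=> h; rewrite -sum1_card (partition_big b predT) //= -sum_nat_const.
apply: leq_sum => j _; apply: leq_trans (h j); rewrite -sum1_card.
by under [leqRHS]eq_bigl do rewrite inE.
Qed.

(** The function [pick] depends only on the extension of its predicate, so [rep] is constant on
    classes and its fixed points form a transversal. *)
Lemma exists_transversal (T : finType) (e : rel T) :
  reflexive e -> symmetric e -> transitive e ->
  exists R : {set T}, {in R &, forall x y, e x y -> x = y} /\
    #|T| = (\sum_(x in R) #|[set y | e x y]%SET|)%N.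
Proof.
move=> eR eS eT; pose rep x := odflt x [pick y | e x y].
have e_rep x : e x (rep x).
  by rewrite /rep; case: pickP => [y //|/(_ x)]; rewrite eR.
have rep_eq x y : e x y -> rep x = rep y.
  move=> exy; rewrite /rep.
  have -> : [pick z | e x z] = [pick z | e y z].
    apply: eq_pick => z; apply/idP/idP; last exact: eT.
    by apply: eT; rewrite eS.
  by case: pickP => // /(_ y); rewrite eR.
pose R := [set x | rep x == x]%SET; exists R; split.
  by move=> x y; rewrite !inE => /eqP xR /eqP yR /rep_eq; rewrite xR yR.
rewrite -sum1_card (partition_big rep (mem R)) /=; last first.
  by move=> x _; rewrite inE eq_sym; apply/eqP/rep_eq.
apply: eq_bigr => x; rewrite inE => /eqP xR; rewrite -sum1_card; apply: eq_bigl => y.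
rewrite inE; apply/eqP/idP => [<-|exy]; first by rewrite eS.
by rewrite -(rep_eq _ _ exy).
Qed.

Section Multiplicity.
Variables (I : finType) (r : nat) (B : I -> 'M[int]_2).
Hypothesis hB : separated_code r B.
Hypothesis r1 : (1 <= r)%N.

Local Notation P := (wprod B).
Local Notation A := (wmx B).
Local Notation wg := (wg B).
Local Notation rR := (r%:R : RR).

Lemma wmx_comm (w w' : seq I) : w != [::] -> w' != [::] -> wg w = wg w' ->
  P w *m P w' = P w' *m P w.
Proof.
move=> w0 w'0 e; apply: intmx_inj; rewrite !intmxM.
have b := balanced_wmx hB w0; have b' := balanced_wmx hB w'0.
have u : wg w \in unitmx := eigmx_unit b.
have h := mul_eigmx b; have h' := mul_eigmx b'.
rewrite -/(wg w) in h; rewrite -/(wg w') -e in h'.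
rewrite -[LHS](mulmxK u) -[RHS](mulmxK u); congr (_ *m _).
rewrite -!mulmxA -/(A w') -/(A w) h h' !mulmxA h h' -!mulmxA; congr (_ *m _).
by rewrite !mul_mx2; congr mx2; ring.
Qed.

(** The second row of [eigmx] is [(1, 1)], which forces the scaling and the flow to cancel, so the
    eigenbases agree and the matrices commute. Freeness then gives [w ++ w' = w' ++ w], and equal
    lengths give [w = w']. *)
Lemma same_axis_eq (w w' : seq I) (c s : RR) : w != [::] -> size w = size w' ->
  wg w' = c *: (wg w *m a_t s) -> w = w'.
Proof.
move=> w0 sw e; have w'0 : w' != [::] by rewrite -size_eq0 -sw size_eq0.
have eg : wg w = wg w'.
  move: e; rewrite a_tE /wg /eigmx mul_mx2 scale_mx2 !mulr0 !addr0 !add0r !mul1r => H.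
  have [h00 h01 h10 h11] := mx2_inj H; apply: mx2P; rewrite !mx2E //.
  - by rewrite h00 mulrCA -h10 mulr1.
  - by rewrite h01 mulrCA -h11 mulr1.
have /(wprod_inj hB) : P (w ++ w') = P (w' ++ w).
  by rewrite !wprod_cat wmx_comm.
rewrite !size_cat addnC => /(_ erefl) /eqP.
by rewrite eqseq_cat // => /andP[/eqP].
Qed.

Definition gbound : nat := Num.bound (2 * rR ^+ 4 * expR (1 / 2) : RR).

(** The matrix [c M] is the product of [wg w'], a flow element of bounded time and the inverse of
    [wg w], all in compact sets. Comparing determinants keeps [c] away from 0, so [M] is bounded
    independently of the words. *)
Lemma gamma_entry_bound (w w' : seq I) (M : 'M[int]_2) (c s : RR) :
  w != [::] -> w' != [::] -> \det M = 1 \/ \det M = -1 -> `|s| <= 1 ->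
  wg w' = c *: (intmx M *m (wg w *m a_t s)) ->
  forall i j, (`|M i j| < gbound)%N.
Proof.
move=> w0 w'0 dM s1 e.
have b := balanced_wmx hB w0; have b' := balanced_wmx hB w'0.
have R1 : 1 <= rR := rR_ge1 r1.
have R0 : 0 < rR by lra.
set D := xi (A w) + eta (A w); set D' := xi (A w') + eta (A w').
have D0 : 0 < D := eigmx_det_gt0 b.
have D'0 : 0 < D' := eigmx_det_gt0 b'.
have D2 : 2 <= rR * D.
  by have := xi_geVr b; have := eta_geVr b; rewrite /D mulrDr; lra.
have D'2 : 2 <= rR * D'.
  by have := xi_geVr b'; have := eta_geVr b'; rewrite /D' mulrDr; lra.
have Dr : D <= 2 * rR by have := xi_ler b; have := eta_ler b; rewrite /D; lra.
have detE : D' = c ^+ 2 * (\det M)%:~R * D.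
  have := congr1 determinant e.
  by rewrite detZ !det_mulmx det_a_t mulr1 !det_eigmx det_intmx mulrA.
have c2 : D' = c ^+ 2 * D.
  case: dM detE => ->; first by rewrite mulr1.
  by rewrite mulrN1 mulNr => h; have := mulr_ge0 (sqr_ge0 c) (ltW D0); lra.
(* From [D' = c^2 D] with [D' >= 2 / r] and [D <= 2 r]. *)
have cr : 1 <= rR * `|c|.
  have h : 1 <= (rR * `|c|) ^+ 2.
    rewrite exprMn real_normK ?num_real //.
    have : rR * D' <= rR * (c ^+ 2 * (2 * rR)).
      by rewrite c2 ler_pM2l // ler_wpM2l // sqr_ge0.
    have -> : rR * (c ^+ 2 * (2 * rR)) = 2 * (rR ^+ 2 * c ^+ 2) by ring.
    by lra.
  by rewrite -(@ler_pXn2r _ 2) ?nnegrE ?mulr_ge0 ?(ltW R0) ?expr1n.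
pose E1 : RR := expR (1 / 2).
have E10 : 0 < E1 := expR_gt0 _.
have es (k : RR) : `|k| <= 1 -> expR (k / 2) <= E1.
  by move=> k1; rewrite ler_expR ler_pM2r // (le_trans (ler_norm _) k1).
have e' : c *: (intmx M *m wg w) = wg w' *m a_t (- s).
  rewrite e -scalemxAl -!mulmxA -a_tD subrr a_t0 mulmx1 //.
have Eb x y : `|(wg w' *m a_t (- s)) x y| <= rR * E1.
  have ub (a k : RR) : `|a| <= rR -> `|k| <= 1 -> `|a * expR (k / 2)| <= rR * E1.
    move=> a1 k1; rewrite normrM (gtr0_norm (expR_gt0 _)).
    by apply: ler_pM; rewrite ?expR_ge0 ?es.
  have x1 := xi_gt0 b'; have x2 := xi_ler b'; have y1 := eta_gt0 b'; have y2 := eta_ler b'.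
  have eN : - (- s / 2) = s / 2 by rewrite mulNr opprK.
  rewrite mulmx22E a_tE eN; move: x y; do 2!apply: ord2P;
    rewrite !mx2E ?mulr0 ?addr0 ?add0r; apply: ub; rewrite ?normrN ?normr1 //.
  - by rewrite gtr0_norm.
  - by rewrite gtr0_norm.
(* The difference of the two coordinates of a row isolates [c * p * D], which bounds [p]; the first
   coordinate then bounds [q]. *)
have pq x : `|(M x 0)%:~R : RR| <= rR ^+ 3 * E1 /\ `|(M x 1)%:~R : RR| <= 2 * rR ^+ 4 * E1.
  set p := (M x 0)%:~R : RR; set q := (M x 1)%:~R : RR.
  have h0 := congr1 (fun X : 'M[RR]_2 => X x 0) e'.
  have h1 := congr1 (fun X : 'M[RR]_2 => X x 1) e'.
  rewrite /= mxE mulmx22E !intmxE !mx2E mulr1 -/p -/q in h0.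
  rewrite /= mxE mulmx22E !intmxE !mx2E mulr1 -/p -/q in h1.
  have E0 := Eb x 0; have E2 := Eb x 1; rewrite -h0 in E0; rewrite -h1 in E2.
  have cp : `|c * p * D| <= 2 * (rR * E1).
    have -> : c * p * D = c * (p * xi (A w) + q) - c * (p * - eta (A w) + q) by rewrite /D; ring.
    by apply: le_trans (ler_normB _ _) _; lra.
  have pb : `|p| <= rR ^+ 3 * E1.
    rewrite !normrM (gtr0_norm D0) in cp.
    have h2 : 2 * `|p| <= (rR * `|c|) * `|p| * (rR * D).
      have : 1 * `|p| <= (rR * `|c|) * `|p| by rewrite ler_wpM2r.
      have : 2 * ((rR * `|c|) * `|p|) <= (rR * D) * ((rR * `|c|) * `|p|).
        by rewrite ler_wpM2r // !mulr_ge0 // ltW.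
      by rewrite mul1r [(rR * D) * _]mulrC; lra.
    have h3 : (rR * `|c|) * `|p| * (rR * D) <= rR ^+ 2 * (2 * (rR * E1)).
      have -> : (rR * `|c|) * `|p| * (rR * D) = rR ^+ 2 * (`|c| * `|p| * D) by ring.
      by rewrite ler_wpM2l // exprn_ge0 // ltW.
    have -> : rR ^+ 3 * E1 = rR ^+ 2 * (rR * E1) by ring.
    by lra.
  split => //.
  have xr := xi_ler b; have x0 := xi_gt0 b.
  have h2 : `|p * xi (A w)| <= rR ^+ 3 * E1 * rR.
    by rewrite normrM (gtr0_norm x0); apply: ler_pM => //; exact: ltW.
  have h3 : `|p * xi (A w) + q| <= rR * (rR * E1).
    have : 1 * `|p * xi (A w) + q| <= (rR * `|c|) * `|p * xi (A w) + q| by rewrite ler_wpM2r.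
    have : rR * `|c * (p * xi (A w) + q)| <= rR * (rR * E1) by rewrite ler_pM2l.
    by rewrite normrM; lra.
  have h4 : `|q| <= `|p * xi (A w) + q| + `|p * xi (A w)|.
    have {1}-> : q = (p * xi (A w) + q) - p * xi (A w) by ring.
    exact: ler_normB.
  have h5 : rR * (rR * E1) <= rR ^+ 4 * E1.
    have -> : rR * (rR * E1) = rR ^+ 2 * E1 by ring.
    by rewrite ler_pM2r // ler_weXn2l.
  have -> : 2 * rR ^+ 4 * E1 = rR ^+ 4 * E1 + rR ^+ 3 * E1 * rR by ring.
  by lra.
move=> x y; rewrite -(ltr_nat RR).
have : `|(M x y)%:~R : RR| <= 2 * rR ^+ 4 * E1.
  move: y; apply: ord2P; last by have [] := pq x.
  have [h _] := pq x; apply: le_trans h _; rewrite ler_pM2r //.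
  have : rR ^+ 3 <= rR ^+ 4 by rewrite ler_weXn2l.
  by have : 0 <= rR ^+ 4; [rewrite exprn_ge0 // ltW|lra].
rewrite natr_absz intr_norm => h; apply: le_lt_trans h _.
by apply: archi_boundP; rewrite mulr_ge0 ?mulr_ge0 ?exprn_ge0 // ltW.
Qed.

End Multiplicity.

(** * Counting words on an orbit and the total volume *)

Section OrbitsOfCode.
Variables (I : finType) (r : nat) (B : I -> 'M[int]_2).
Hypothesis hB : separated_code r B.
Hypothesis r1 : (1 <= r)%N.

Local Notation A := (wmx B).
Local Notation wg := (wg B).
Local Notation rR := (r%:R : RR).

Definition same_orbit k (w w' : k.-tuple I) : bool :=
  `[< orbitset (wg w) = orbitset (wg w') >].

Definition ngamma : nat := #|{ffun 'I_2 * 'I_2 -> 'I_(2 * gbound r).+1}|.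

(** Each word is reached from [w1] through an integer matrix with bounded entries. Two words sharing
    that matrix differ by scaling and flow only, hence coincide by [same_axis_eq]. *)
Lemma near_class_card k (w1 : k.-tuple I) (F : {set k.-tuple I}) : (0 < k)%N ->
  (forall w, w \in F -> exists s, `|s| <= 1 /\ gamma_equiv (wg w1 *m a_t s) (wg w)) ->
  (#|F| <= ngamma)%N.
Proof.
move=> k0 hF.
have wn0 (w : k.-tuple I) : (w : seq I) != [::] by rewrite -size_eq0 size_tuple -lt0n.
have /choice[Ms hM] (w : k.-tuple I) : exists M, w \in F ->
    exists c s, [/\ \det M = 1 \/ \det M = -1, c != 0, `|s| <= 1 &
      wg w = c *: (intmx M *m (wg w1 *m a_t s))].
  have [wF|_] := boolP (w \in F); last by exists 0.
  have [s [s1 [M [c [dM [c0 e]]]]]] := hF w wF.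
  by exists M => _; exists c, s.
(* Shifting by [gbound r] makes the entries nonnegative and at most [2 * gbound r], so that [inord]
   loses nothing. *)
pose enc w : {ffun 'I_2 * 'I_2 -> 'I_(2 * gbound r).+1} :=
  [ffun p => inord (absz (Ms w p.1 p.2 + (gbound r)%:Z))].
rewrite -(@card_in_imset _ _ enc); first exact: max_card.
move=> w w' wF w'F /ffunP e.
have [c [s [dM c0 s1 gw]]] := hM w wF.
have [c' [s' [dM' c'0 s'1 gw']]] := hM w' w'F.
have bM := gamma_entry_bound hB r1 (wn0 _) (wn0 _) dM s1 gw.
have bM' := gamma_entry_bound hB r1 (wn0 _) (wn0 _) dM' s'1 gw'.
have MM : Ms w = Ms w'.
  apply/matrixP => i j; have := e (i, j); rewrite !ffunE /= => /(congr1 val).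
  have := bM i j; have := bM' i j; rewrite /= => h h'.
  by rewrite !inordK; lia.
apply: val_inj; apply: (@same_axis_eq _ _ _ hB _ _ (c' / c) (s' - s)).
- exact: wn0.
- by rewrite !size_tuple.
rewrite gw' gw -MM -scalemxAl scalerA divfK // -!mulmxA -a_tD.
by rewrite [s + _]addrC subrK.
Qed.

(** Times are reduced modulo [v] and grouped by integer part. This gives at most [truncn v + 1]
    windows, and two words in one window are at time distance at most 1. *)
Lemma orbit_class_card k (w0 : k.-tuple I) (v : RR) : (0 < k)%N -> is_vol (wg w0) v ->
  (#|[set w | same_orbit w0 w]%SET| <= (Num.truncn v).+1 * ngamma)%N.
Proof.
move=> k0 [v0 [gv _]]; set S := finset _.
have /choice[t ht] (w : k.-tuple I) : exists t, w \in S ->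
    [/\ 0 <= t, t < v & gamma_equiv (wg w0 *m a_t t) (wg w)].
  have [wS|_] := boolP (w \in S); last by exists 0.
  move: wS; rewrite inE => /asboolP /orbitset_eqP[t gt].
  have [s [s0 sv gs]] := gamma_equiv_mod_period t v0 gv.
  by exists s => _; split => //; exact: (gamma_equiv_trans gs gt).
rewrite -{1}[(Num.truncn v).+1]card_ord.
apply: (card_le_fibers (b := fun w => inord (Num.truncn (t w)))) => j.
set F := finset _.
have [->|[w1 w1F]] := set_0Vmem F; first by rewrite cards0.
apply: (near_class_card (w1 := w1)) => // w.
move: w1F; rewrite inE => /andP[w1S /eqP b1]; rewrite inE => /andP[wS /eqP b2].
have [t0 tv gt] := ht _ wS; have [t10 t1v gt1] := ht _ w1S.
exists (t w - t w1); split.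
  have tt : Num.truncn (t w) = Num.truncn (t w1).
    have := congr1 val (etrans b2 (esym b1)); rewrite /= !inordK //.
    - by rewrite ltnS le_truncn // ltW.
    - by rewrite ltnS le_truncn // ltW.
  have /andP[h1 h2] := truncn_itv t0; have /andP[h3 h4] := truncn_itv t10.
  rewrite tt in h1 h2; rewrite -natr1 in h2; rewrite -natr1 in h4.
  by rewrite ler_norml; apply/andP; split; lra.
apply: gamma_equiv_trans gt.
have := gamma_equivMr (a_t (t w - t w1)) (gamma_equiv_sym gt1).
by rewrite -[_ *m _ *m a_t (t w - _)]mulmxA -a_tD [t w1 + _]addrC subrK.
Qed.

Lemma orbits_of_code : exists c : RR, 0 < c /\ forall k, (0 < k)%N ->
  exists (n : nat) (gs : 'I_n -> 'M[RR]_2) (vs : 'I_n -> RR),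
    (forall i : 'I_n,
       gs i \in unitmx /\ periodic_orbit (gs i) /\
       (exists d : RR, is_disc (gs i) d /\ d <= 16 * (2 * rR) ^+ (2 * k)) /\
       (forall x, orbitset (gs i) x -> in_Omega' (8 * rR ^+ 7)^-1 x) /\
       is_vol (gs i) (vs i)) /\
    (forall i j : 'I_n, orbitset (gs i) = orbitset (gs j) -> i = j) /\
    c * #|I|%:R ^+ k <= \sum_(i < n) vs i.
Proof.
pose q : RR := 2 * ln 2.
have q0 : 0 < q by rewrite mulr_gt0 // ln_gt0 // ltr1n.
(* Since [q <= v], the number of windows is at most [v + 1 <= v * (1 + 1/q)], so an orbit of volume
   [v] carries at most [v * K] words. *)
pose K : RR := ngamma%:R * (1 + q^-1).
have K0 : 0 < K.
  rewrite mulr_gt0 ?addr_gt0 ?invr_gt0 // ltr0n /ngamma card_ffun expn_gt0.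
  by rewrite card_ord.
exists K^-1; split; first by rewrite invr_gt0.
move=> k k0; pose W : finType := (k.-tuple I)%type.
have wn0 (w : W) : (w : seq I) != [::] by rewrite -size_eq0 size_tuple -lt0n.
have bw (w : W) : balanced rR (A w) by exact: balanced_wmx.
have gw (w : W) : gamma_equiv (wg w) (wg w *m a_t (period (A w))).
  exact: (gamma_equiv_period (bw w) (det_wprod hB w)).
have uw (w : W) : wg w \in unitmx := eigmx_unit (bw w).
have /choice[v hv] (w : W) : exists v, is_vol (wg w) v /\ q <= v.
  exact: exists_is_vol (uw w) (period_gt0 (bw w)) (gw w).
have [||| R [Rinj cardW]] := @exists_transversal W (@same_orbit k).
- by move=> w; apply/asboolP.
- by move=> w w'; apply/idP/idP => /asboolP e; apply/asboolP.
- by move=> w w' w'' /asboolP e /asboolP e'; apply/asboolP; rewrite e.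
exists #|R|, (fun i => wg (enum_val i : W)), (fun i => v (enum_val i)); split; [|split].
- move=> i; set w : W := enum_val i; split; [exact: uw|split; [|split; [|split]]].
  + exact: periodic_orbit_of_period (period_gt0 (bw w)) (gw w).
  + have [d [dd dle]] := exists_disc_le (bw w); exists d; split => //.
    apply: le_trans dle _.
    have h x y : intmx (wprod B w) x y <= (2 * rR) ^+ k.
      by rewrite -[X in _ ^+ X](size_tuple w); exact: wmx_le hB w x y.
    have p x y : 0 < intmx (wprod B w) x y := bal_gt0 (bw w) x y.
    have -> : 16 * (2 * rR) ^+ (2 * k) = 4 * (2 * (2 * rR) ^+ k) ^+ 2.
      by rewrite mulnC exprM exprMn; ring.
    have hs : intmx (wprod B w) 0 0 + intmx (wprod B w) 1 1 <= 2 * (2 * rR) ^+ k.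
      by have := h 0 0; have := h 1 1; move: ((2 * rR) ^+ k) => X; lra.
    by rewrite ler_pM2l // lerXn2r // nnegrE ?addr_ge0 ?mulr_ge0 ?exprn_ge0 ?mulr_ge0 // ltW.
  + by move=> x; exact: orbit_in_Omega'.
  + by have [] := hv w.
- move=> i j /asboolP e; apply: enum_val_inj.
  exact: Rinj (enum_valP i) (enum_valP j) e.
rewrite -(big_enum_val v).
rewrite mulrC ler_pdivrMr //.
have -> : #|I|%:R ^+ k = #|W|%:R :> RR by rewrite card_tuple natrX.
rewrite cardW natr_sum mulr_suml; apply: ler_sum => w wR.
have [vw qv] := hv w.
have := orbit_class_card k0 vw; rewrite -(ler_nat RR) natrM => h.
apply: le_trans h _.
have v0 : 0 <= v w by apply: le_trans qv; exact: ltW.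
have -> : v w * K = (v w + v w / q) * ngamma%:R by rewrite /K; ring.
rewrite ler_wpM2r // -natr1.
have /andP[h1 _] := truncn_itv v0.
have : 1 <= v w / q by rewrite ler_pdivlMr // mul1r.
by lra.
Qed.

End OrbitsOfCode.

(** * A separated code of nearly quadratic size *)

Section Nat.
Local Open Scope nat_scope.

(** Sum the identity [n = \sum_(d | n) totient d] over [n <= K] and exchange the sums: [d] has
    [K %/ d] multiples in the range. *)
Lemma sum_totient_divn (K : nat) :
  \sum_(1 <= n < K.+1) n = \sum_(1 <= d < K.+1) totient d * (K %/ d).
Proof.
under [RHS]eq_bigr do rewrite divn_count_dvd big_distrr /=.
rewrite exchange_big /=; apply: eq_big_nat => n /andP[n0 nK].
rewrite -{1}(cyclic.sum_totient_dvd n) big_mkcond.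
rewrite -(big_mkord xpredT (fun d => if d %| n then totient d else 0)).
rewrite big_ltn // dvd0n (gtn_eqF n0) /= add0n.
rewrite [RHS](@big_cat_nat _ _ _ n.+1) //= [X in _ = _ + X]big_nat_cond [X in _ = _ + X]big1 ?addn0.
  by apply: eq_bigr => d _; case: (d %| n); rewrite ?muln1 ?muln0.
move=> d /andP[/andP[nd dK] _]; rewrite [d %| n](_ : _ = false) ?muln0 //.
by apply/negP => /(dvdn_leq n0); rewrite leqNgt nd.
Qed.

(** Apply the previous identity with [K = 4 L], whose left side is [8 L^2 + 2 L]. The terms with
    [d <= L] are at most [4 L] each, and for [d > L] the quotient is at most 3. *)
Lemma sum_totient_ge (L : nat) :
  4 * L ^ 2 + 2 * L <= 3 * \sum_(L.+1 <= d < (4 * L).+1) totient d.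
Proof.
have gauss n : 2 * \sum_(1 <= i < n.+1) i = n * n.+1.
  by elim: n => [|n IH]; [rewrite big_nil|rewrite big_nat_recr //= mulnDr IH; lia].
have := sum_totient_divn (4 * L); have := gauss (4 * L).
move: (\sum_(1 <= i < (4 * L).+1) i) => s sE.
rewrite (@big_cat_nat _ _ _ L.+1) //=; last by lia.
set s1 := bigop _ _ _; set s2 := bigop _ _ _ => sE'.
have h1 : s1 <= L * (4 * L).
  have <- : \sum_(1 <= d < L.+1) (4 * L) = L * (4 * L) by rewrite sum_nat_const_nat subn1.
  rewrite /s1.
  rewrite big_nat_cond [leqRHS]big_nat_cond; apply: leq_sum => d /andP[/andP[d0 _] _].
  apply: leq_trans (leq_mul _ (leqnn _)) (_ : d * (4 * L %/ d) <= _).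
    rewrite totient_count_coprime; apply: leq_trans (_ : \sum_(0 <= i < d) 1 <= _).
      by apply: leq_sum => i _; case: coprime.
    by rewrite sum_nat_const_nat subn0 muln1.
  by rewrite mulnC leq_trunc_div.
have h2 : s2 <= 3 * \sum_(L.+1 <= d < (4 * L).+1) totient d.
  rewrite /s2 big_distrr /= big_nat_cond [leqRHS]big_nat_cond.
  apply: leq_sum => d /andP[/andP[d0 _] _]; rewrite mulnC leq_mul2r; apply/orP; right.
  by rewrite -ltnS ltn_divLR //; lia.
by lia.
Qed.

(** The condition [1 < p.2] also makes [p.1] positive, because 0 is coprime only to 1. *)
Definition farey_pair (K : nat) (p : 'I_K.+1 * 'I_K.+1) : bool :=
  [&& 1 < p.2, p.1 < p.2 & coprime p.1 p.2].

Lemma card_farey_pair (L : nat) : 0 < L ->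
  L ^ 2 <= #|{: {p | @farey_pair (4 * L) p}}|.
Proof.
move=> L0; rewrite card_sig -sum1_card.
set K := 4 * L.
have -> : \sum_(p in [pred p | @farey_pair K p]) 1 =
    \sum_(c < K.+1 | 1 < c) \sum_(a < K.+1 | (a < c) && coprime a c) 1.
  rewrite [RHS](exchange_big_dep xpredT) //= pair_big_dep /=.
  by apply: eq_bigl => -[a c].
have -> : \sum_(c < K.+1 | 1 < c) \sum_(a < K.+1 | (a < c) && coprime a c) 1
    = \sum_(c < K.+1 | 1 < c) totient c.
  apply: eq_bigr => c _; rewrite totient_count_coprime big_mkord.
  rewrite (big_ord_widen _ (fun i => nat_of_bool (coprime c i)) (ltnW (ltn_ord c))).
  rewrite big_mkcondr /=; apply: eq_bigr => a _.
  by rewrite coprime_sym; case: coprime.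
rewrite -(big_mkord (fun c => 1 < c) totient).
have h := sum_totient_ge L.
have : \sum_(L.+1 <= d < K.+1) totient d <= \sum_(0 <= d < K.+1 | 1 < d) totient d.
  rewrite [leqRHS](@big_cat_nat _ _ _ L.+1) //=; last by rewrite /K; lia.
  apply: leq_trans (leq_addl _ _); rewrite [leqRHS]big_mkcond /=.
  rewrite big_nat_cond [leqRHS]big_nat_cond; apply: leq_sum => d /andP[/andP[d0 _] _].
  by rewrite ifT //; lia.
by rewrite -/K in h; lia.
Qed.

End Nat.

(** The entry [d] is the inverse of [a] modulo [c] lying among the [c] integers following [K]; then
    [b = (a d - 1) / c]. *)
Lemma exists_code_matrix (K a c : nat) : (1 < c)%N -> (a < c)%N -> (c <= K)%N -> coprime a c ->
  exists M : 'M[int]_2, [/\ M 0 0 = a%:Z, M 1 0 = c%:Z, \det M = 1,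
    1 <= M 0 1 <= (2 * K)%N%:Z & K%:Z < M 1 1 <= (2 * K)%N%:Z].
Proof.
move=> c1 ac cK co.
have a0 : (0 < a)%N by case: a co {ac} => //; rewrite /coprime gcd0n => /eqP e; rewrite e in c1.
have /(coprimeP _ a0)[[u1 u2] /= u] := co.
have uE : (u1 * a = u2 * c + 1)%N by lia.
(* Adding [c * K.+1] keeps the natural subtraction from truncating; the residue [y] of [x] modulo
   [c] makes [K.+1 + y] congruent to [u1]. *)
pose x := (u1 + c * K.+1 - K.+1)%N.
have xE : (x + K.+1 = u1 + c * K.+1)%N by rewrite subnK //; nia.
have xd := divn_eq x c.
have xm : (x %% c < c)%N by rewrite ltn_mod; lia.
move: (x %/ c)%N (x %% c)%N xd xm => q y xd xm.
pose d : int := (K.+1 + y)%N%:Z.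
pose b : int := u2%:Z + a%:Z * (K.+1%:Z - q%:Z).
have dE : d = u1%:Z + c%:Z * K.+1%:Z - q%:Z * c%:Z by rewrite /d; lia.
have uZ : u1%:Z * a%:Z = u2%:Z * c%:Z + 1 by lia.
have det1 : a%:Z * d - b * c%:Z = 1.
  have -> : a%:Z * d - b * c%:Z = u1%:Z * a%:Z - u2%:Z * c%:Z by rewrite dE /b; ring.
  by rewrite uZ; ring.
exists (mx2 a%:Z b c%:Z d); rewrite det_mx2 !mx2E.
have dK : K%:Z < d by rewrite /d; lia.
have dK2 : d <= (2 * K)%N%:Z by rewrite /d; lia.
split => //; last by rewrite dK dK2.
have bc : b * c%:Z = a%:Z * d - 1 by rewrite -det1; ring.
have c0 : 0 < c%:Z by lia.
have ad : 1 < a%:Z * d by nia.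
have b1 : 1 <= b.
  rewrite -gtz0_ge1 -(pmulr_lgt0 _ c0) bc; lia.
have b2 : b <= (2 * K)%N%:Z.
  have h : a%:Z * d <= c%:Z * (2 * K)%N%:Z by apply: ler_pM => //; rewrite /d; lia.
  by rewrite -(ler_pM2r c0) bc [leRHS]mulrC; apply: le_trans h; rewrite gerBl.
by rewrite b1 b2.
Qed.

(* [M] maps the closed positive cone to slopes at most [a/c], whereas the image under [M']
   only has slopes at least [b'/d' = a'/c' - 1/(c'd')], which exceeds [a/c]
   because [a'/c' - a/c >= 1/(cc')] and [d' > c]. *)
Lemma cones_disjoint (M M' : 'M[int]_2) (u v : 'cV[int]_2) :
  \det M = 1 -> \det M' = 1 -> 0 < M 1 0 -> 0 < M' 1 0 -> 0 < M 1 1 -> M 1 0 < M' 1 1 ->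
  u != 0 -> (forall x, 0 <= u x 0) -> (forall x, 0 <= v x 0) ->
  M *m u = M' *m v -> M' 0 0 * M 1 0 <= M 0 0 * M' 1 0.
Proof.
rewrite !det_mx2.
move=> dM dM' c0 c'0 d0 cd u0 ug vg e.
have e0 := congr1 (fun X : 'cV[int]_2 => X 0 0) e.
have e1 := congr1 (fun X : 'cV[int]_2 => X 1 0) e.
rewrite /= !mulmx22E in e0 e1.
have x0 := ug 0; have y0 := ug 1; have x'0 := vg 0; have y'0 := vg 1.
have u1 : (0 < u 0 0) || (0 < u 1 0).
  rewrite !lt0r x0 y0 !andbT -negb_and; apply: contra u0 => /andP[/eqP h0 /eqP h1].
  by apply/eqP/matrixP => i j; rewrite ord1 mxE; move: i; apply: ord2P.
move: (M 0 0) (M 0 1) (M 1 0) (M 1 1) (M' 0 0) (M' 0 1) (M' 1 0) (M' 1 1)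
  (u 0 0) (u 1 0) (v 0 0) (v 1 0) dM dM' c0 c'0 d0 cd e0 e1 x0 y0 x'0 y'0 u1.
move=> a b c d a' b' c' d' x y x' y' dM dM' c0 c'0 d0 cd e0 e1 x0 y0 x'0 y'0 u1.
rewrite leNgt; apply/negP => lt.
pose p := a * x + b * y; pose q := c * x + d * y.
have q0 : 0 < q.
  case/orP: u1 => h; rewrite /q.
  - by rewrite ltr_pwDl ?mulr_gt0 // mulr_ge0 // ltW.
  - by rewrite ltr_wpDl ?mulr_gt0 // mulr_ge0 // ltW.
have pc : p * c <= a * q.
  have -> : p * c = a * q - y * (a * d - b * c) by rewrite /p /q; ring.
  by rewrite dM; lia.
have pd : q * b' <= p * d'.
  have -> : p * d' = q * b' + x' * (a' * d' - b' * c') by rewrite /p /q e0 e1; ring.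
  by rewrite dM'; lia.
have bd : 1 <= b' * c - a * d'.
  rewrite -gtz0_ge1 -(pmulr_rgt0 _ c'0).
  have -> : c' * (b' * c - a * d') = d' * (a' * c - a * c') - c * (a' * d' - b' * c') by ring.
  have h1 : 1 <= a' * c - a * c' by rewrite -gtz0_ge1 subr_gt0.
  rewrite dM' mulr1 subr_gt0; apply: (lt_le_trans cd).
  by rewrite ler_peMr // ltW // (lt_trans c0).
have h1 : q * b' * c <= p * d' * c by rewrite ler_pM2r.
have d'0 : 0 < d' := lt_trans c0 cd.
have h2 : p * c * d' <= a * q * d' by rewrite ler_pM2r.
have h3 : q * 1 <= q * (b' * c - a * d') by rewrite ler_pM2l.
have e2 : p * c * d' = p * d' * c by ring.
have e3 : q * (b' * c - a * d') = q * b' * c - a * q * d' by ring.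
by rewrite e3 mulr1 in h3; rewrite e2 in h2; lia.
Qed.

Lemma exists_code (L : nat) : (0 < L)%N ->
  exists (I : finType) (B : I -> 'M[int]_2),
    separated_code (8 * L) B /\ (L ^ 2 <= #|I|)%N.
Proof.
move=> L0; pose K := (4 * L)%N.
pose I : finType := {p | @farey_pair K p}.
have /choice[B hB] (p : I) : exists M : 'M[int]_2,
    [/\ M 0 0 = (val p).1%:Z, M 1 0 = (val p).2%:Z, \det M = 1,
    1 <= M 0 1 <= (2 * K)%N%:Z & K%:Z < M 1 1 <= (2 * K)%N%:Z].
  case: p => -[a c] /= /and3P[c1 ac co]; apply: exists_code_matrix => //.
  by rewrite -ltnS.
exists I, B; split; last exact: card_farey_pair.
have rng (p : I) : [/\ (1 < (val p).2)%N, ((val p).1 < (val p).2)%N, ((val p).2 <= K)%N,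
    (0 < (val p).1)%N & coprime (val p).1 (val p).2].
  case: p => -[a c] /= /and3P[/= c1 ac co]; split => //; first by rewrite -ltnS.
  by case: (a : nat) co => //; rewrite /coprime gcd0n => /eqP e; rewrite e in c1.
have K2 : (2 * K = 8 * L)%N by rewrite /K; lia.
split.
- move=> p x y; have [m00 m10 _ /andP[m01 m01'] /andP[m11 m11']] := hB p.
  have [c1 ac cK a0 co] := rng p.
  move: x y; do 2!apply: ord2P; rewrite ?m00 ?m10; split; lia.
- by move=> p; have [] := hB p.
move=> p p' u v u0 ug vg e.
have [m00 m10 dM /andP[m01 m01'] /andP[m11 m11']] := hB p.
have [n00 n10 dN /andP[n01 n01'] /andP[n11 n11']] := hB p'.
have [c1 ac cK a0 co] := rng p; have [c1' ac' cK' a0' co'] := rng p'.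
have v0 : v != 0.
  apply: contra u0 => /eqP v0; rewrite v0 mulmx0 in e.
  have uB : B p \in unitmx by rewrite unitmxE dM.
  by rewrite -[u](mulKmx uB) e mulmx0.
(* Lower left entries are at most [K] and lower right entries exceed [K], so [cones_disjoint]
   applies in both directions. The two fractions are then equal, and being reduced they have the
   same numerator and denominator. *)
have le1 : B p' 0 0 * B p 1 0 <= B p 0 0 * B p' 1 0.
  by apply: cones_disjoint u0 ug vg e => //; lia.
have le2 : B p 0 0 * B p' 1 0 <= B p' 0 0 * B p 1 0.
  by apply: cones_disjoint v0 vg ug (esym e) => //; lia.
rewrite m00 m10 n00 n10 in le1 le2.
have eac : ((val p).1 * (val p').2 = (val p').1 * (val p).2)%N by lia.
have ec : (val p).2 = (val p').2 :> nat.
  apply/eqP; rewrite eqn_dvd.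
  have -> : ((val p).2 %| (val p').2)%N.
    by rewrite -(@Gauss_dvdr _ (val p).1) ?eac ?dvdn_mull // coprime_sym.
  by rewrite -(@Gauss_dvdr _ (val p').1) -?eac ?dvdn_mull // coprime_sym.
have ea : (val p).1 = (val p').1 :> nat.
  by apply/eqP; rewrite -(@eqn_pmul2r (val p).2) -?eac ?ec //; lia.
apply: val_inj; move: ea ec; case: (val p) (val p') => [a c] [a' c'] /= ea ec.
by congr pair; exact: val_inj.
Qed.

(** * Choice of the code and of the word length *)

Theorem theorem1p2 :
  forall eps : RR, 0 < eps ->
  exists delta : RR, 0 < delta /\
  exists C : RR, 0 < C /\
  exists Delta0 : RR, forall Delta : RR, Delta0 <= Delta ->
    exists (n : nat) (gs : 'I_n -> 'M[RR]_2) (vs : 'I_n -> RR),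
      (forall i : 'I_n,
         gs i \in unitmx /\ periodic_orbit (gs i) /\
         (exists d : RR, is_disc (gs i) d /\ d <= Delta) /\
         (forall x, orbitset (gs i) x -> in_Omega' delta x) /\
         is_vol (gs i) (vs i)) /\
      (forall i j : 'I_n, orbitset (gs i) = orbitset (gs j) -> i = j) /\
      C * Delta `^ (1 - eps) <= \sum_(i < n) vs i.
Proof.
move=> eps eps0.
(* Capping at [1/2] keeps [1 - e] positive, as monotonicity of the power requires. *)
pose e : RR := Num.min eps (1 / 2).
have e0 : 0 < e by rewrite lt_min eps0; lra.
have e_eps : e <= eps by rewrite ge_min lexx.
have e12 : e <= 1 / 2 by rewrite ge_min lexx orbT.
(* With [Q = 256 L^2], the bound [L >= x] yields [Q^e >= 256], so the [L^2 = Q / 256] letters number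
   at least [Q^(1 - e)]. *)
pose x : RR := 256 `^ (1 / (2 * e)).
pose L := (Num.truncn x).+1.
have xL : x <= L%:R.
  by have /andP[_ h] := truncn_itv (powR_ge0 256 (1 / (2 * e)) : 0 <= x); exact: ltW.
have L0 : (0 < L)%N by [].
have L1 : 1 <= L%:R :> RR by rewrite ler1n.
have [I [B [hB cardI]]] := exists_code L0.
have r1 : (1 <= 8 * L)%N by rewrite muln_gt0.
have [c [c0 orbits]] := orbits_of_code hB r1.
pose s : RR := 2 * (8 * L)%N%:R.
have sE : s = 16 * L%:R by rewrite /s natrM; ring.
pose Q : RR := s ^+ 2.
have s1 : 1 < s by rewrite sE; lra.
have Q1 : 1 < Q by rewrite /Q expr_gt1 //; lra.
have Q0 : 0 < Q by lra.
have QI : Q `^ (1 - e) <= #|I|%:R.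
  have hQ : 256 <= Q `^ e.
    have -> : 256 = x `^ (2 * e).
      have e2 : 1 / (2 * e) * (2 * e) = 1 by field; rewrite gt_eqF.
      by rewrite /x -powRrM e2 powRr1 ?ler0n.
    have -> : Q `^ e = s `^ (2 * e).
      by rewrite /Q -powR_mulrn ?powRrM //; lra.
    apply: ge0_ler_powR; rewrite ?nnegrE ?powR_ge0 //; [lra|lra|].
    by apply: le_trans xL _; rewrite sE; lra.
  have -> : Q `^ (1 - e) = Q / Q `^ e.
    have hb : (1 == e) ==> (Q != 0) by rewrite (gt_eqF Q0) implybT.
    by rewrite (powRB hb) (powRr1 (ltW Q0)).
  have h : (L ^ 2)%N%:R <= #|I|%:R :> RR by rewrite ler_nat.
  apply: le_trans h; rewrite ler_pdivrMr; last by lra.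
  have QE : Q = (L ^ 2)%N%:R * 256 by rewrite /Q sE natrX; ring.
  by rewrite [leLHS]QE ler_wpM2l ?ler0n.
(* This is the discriminant bound for words of length 1, so beyond it a positive length is always
   available. *)
pose D0 : RR := 16 * Q.
have D01 : 1 < D0 by rewrite /D0; lra.
have D00 : 0 < D0 by lra.
have P0 : 0 < D0 `^ (1 - e) by rewrite powR_gt0; lra.
exists (8 * (8 * L)%N%:R ^+ 7)^-1; split.
  by rewrite invr_gt0 mulr_gt0 // exprn_gt0 // ltr0n.
exists (c / D0 `^ (1 - e)); split; first by rewrite divr_gt0.
exists D0 => Delta hD.
(* Take the largest length whose discriminant bound fits below [Delta]; the next one overshoots,
   which costs only the constant factor [D0]. *)
have [k [k0 kle klt]] : exists k, [/\ (0 < k)%N, 16 * Q ^+ k <= Delta & Delta < D0 * Q ^+ k].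
  have exn : exists n, Delta < 16 * Q ^+ n.
    have [n hn] := expr_unbounded Delta Q1; exists n.
    by apply: lt_le_trans hn _; rewrite ler_peMl ?exprn_ge0 //; lra.
  case: (ex_minnP exn) => -[|[|k]] hn hmin.
  - by move: hn; rewrite expr0 mulr1 /D0 in hD *; lra.
  - by move: hn; rewrite expr1 -/D0 ltNge hD.
  exists k.+1; split => //.
  - by rewrite leNgt; apply/negP => /hmin; rewrite ltnn.
  - by rewrite /D0 -mulrA -exprS.
have [n [gs [vs [Hgs [inj Hsum]]]]] := orbits k k0.
exists n, gs, vs; split; last split => //.
  move=> i; have [h1 [h2 [[d [h3 h4]] h5]]] := Hgs i.
  split => //; split => //; split => //; exists d; split => //.
  by apply: le_trans h4 _; rewrite exprM.
apply: le_trans Hsum.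
have DD : Delta `^ (1 - eps) <= D0 `^ (1 - e) * #|I|%:R ^+ k.
  have D1 : 1 <= Delta by lra.
  apply: le_trans (ler_powR D1 (_ : 1 - eps <= 1 - e)) _; first by lra.
  have h : Delta `^ (1 - e) <= (D0 * Q ^+ k) `^ (1 - e).
    apply: ge0_ler_powR; rewrite ?nnegrE; [lra|lra| |exact: ltW].
    by rewrite mulr_ge0 // ?exprn_ge0 //; lra.
  apply: le_trans h _; rewrite powRM ?(ltW D00) ?(exprn_ge0 k (ltW Q0)) //.
  rewrite ler_pM2l // -(powR_mulrn _ (ltW Q0)).
  rewrite -powRrM mulrC powRrM powR_mulrn ?powR_ge0 //.
  by rewrite lerXn2r // nnegrE ?powR_ge0 ?ler0n.
have c1 : 0 <= c / D0 `^ (1 - e) by rewrite ltW // divr_gt0.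
apply: le_trans (ler_wpM2l c1 DD) _.
by rewrite mulrA divfK ?lexx // gt_eqF.
Qed.
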